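(* Consider the general convex case $\alpha=0$, and let $\{(z_k,u_k,\lambda_k)\}$ be generated by the stochastic ADMM algorithm described in the context with the following parameters: $\rho_k=\rho$, $\eta_k=\eta$, $\theta_k=k+1$ for all $k$, where $\rho,\eta>0$ are constants with $\eta>\mu\rho/(1-\mu)+L$; and batch sizes satisfying $\sum_{k=0}^{\infty}\frac1{m_k}=\frac1M<\infty$ for a constant $M>0$. Suppose $f$ is convex with $L$-Lipschitz gradient, and the stochastic gradient is unbiased with variance bounded by $\varrho^2$ (both as specified in the context). Then for any $c>0$ with $c\ge2\|\lambda^{\ast}\|$ and every $K\ge1$, $$\mathbb E\big[f(u_K)+g(z_K)-f(u^{\ast})-g(z^{\ast})\big]\le\frac{C_2}{K}\quad\text{and}\quad\mathbb E\big[\|u_K-z_K\|\big]\le\frac{2C_2}{cK},$$ where $$C_2=\frac{\varrho^2\phi_1}{2M}+\frac{\eta+\rho}{2}\|u_0-u^{\ast}\|^2+\frac{c^2+\|\lambda_0\|^2}{\mu\rho},\qquad \phi_1=\frac{1-\mu}{\eta(1-\mu)-\mu\rho-L(1-\mu)}.$$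
   Context: Setting. $U$ is a real Hilbert space with inner product $\langle\cdot,\cdot\rangle$ and norm $\|\cdot\|$; $U_{ad}\subset U$ is nonempty, closed and convex. $(\Omega,\mathcal F,\mathbb P)$ is a probability space, $\xi:\Omega\to\Xi\subset\mathbb R^n$ a random vector, and $f(u)=\mathbb E[F(u,\xi)]$ is well defined and finite for every $u\in U$, where for each $\xi\in\Xi$ the functional $F(\cdot,\xi)$ is convex and Fréchet differentiable; $f$ is then convex and Fréchet differentiable. $\nabla F(u,\xi)$ denotes the gradient in $u$. $g:U\to(-\infty,+\infty]$ is proper, lower semicontinuous and convex. Assumption on $f$ (with $\alpha=0$). For all $u,v\in U$, $f(u)+\langle\nabla f(u),v-u\rangle\le f(v)$ and $\|\nabla f(u)-\nabla f(v)\|\le L\|u-v\|$. Assumption on the stochastic gradient. For all $u\in U$, $\mathbb E[\nabla F(u,\xi)]=\nabla f(u)$ and $\mathbb E[\|\nabla F(u,\xi)-\nabla f(u)\|^2]\le\varrho^2$. Problem. $\min_{u\in U_{ad},\,z\in U} f(u)+g(z)$ subject to $u=z$. $(u^{\ast},z^{\ast})$ is an optimal solution (so $u^{\ast}=z^{\ast}\in U_{ad}$) and $\lambda^{\ast}\in U$ an associated optimal Lagrange multiplier, i.e. $g(z)-g(z^{\ast})+\langle\nabla f(u^{\ast}),u-u^{\ast}\rangle-\langle\lambda^{\ast},u-z\rangle\ge 0$ for all $u\in U_{ad}$, $z\in U$; such a triple is assumed to exist. Algorithm. Choose (deterministic) $(u_0,z_0)=(v_0,s_0)\in U\times U$, initial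 multipliers $\psi_0=\lambda_0\in U$, and $\mu\in(0,1)$. For $k=0,1,2,\dots$: with parameters $\rho_k>0$, $\eta_k>0$, an integer $m_k>1$ and $\theta_k\ge 1$, generate realizations $\xi_{k,1},\dots,\xi_{k,m_k}$ of $\xi$ (all $\xi_{k,i}$, over all $k$ and $i$, are independent and distributed as $\xi$), set $G_k=\frac1{m_k}\sum_{i=1}^{m_k}\nabla F(v_k,\xi_{k,i})$, and compute $$ \begin{aligned} s_{k+1}&=\arg\min_{z\in U}\Big\{g(z)+\langle\lambda_k,z\rangle+\tfrac{\rho_k}{2}\|z-v_k\|^2\Big\},\\ v_{k+1}&=\arg\min_{u\in U_{ad}}\Big\{\langle G_k-\lambda_k,u\rangle+\tfrac{\rho_k}{2}\|u-s_{k+1}\|^2+\tfrac{\eta_k}{2}\|u-v_k\|^2\Big\},\\ \psi_{k+1}&=\psi_k-\mu\rho_k(v_{k+1}-s_{k+1}),\\ u_{k+1}&=(1-\theta_k^{-1})u_k+\theta_k^{-1}v_{k+1},\\ z_{k+1}&=(1-\theta_k^{-1})z_k+\theta_k^{-1}s_{k+1},\\ \lambda_{k+1}&=\psi_{k+1}-\mu\rho_k\theta_k(u_{k+1}-z_{k+1}). \end{aligned} $$ *)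

(* Defs.v *)
From HB Require Import structures.
From mathcomp Require Import all_boot all_order all_algebra.
From mathcomp Require Import all_classical all_reals all_analysis.
Import Order.TTheory GRing.Theory Num.Theory numFieldNormedType.Exports.

Set Implicit Arguments.
Unset Strict Implicit.
Unset Printing Implicit Defensive.

Local Open Scope classical_set_scope.
Local Open Scope ring_scope.

Section bochner.
Context {d : measure_display} {T : measurableType d} {R : realType}.
Context {V : normedModType R}.

Definition simple_function (s : T -> V) : Prop :=
  finite_set (range s) /\ forall x : V, measurable (s @^-1` [set x]).

(* Strong measurability with respect to the trace sigma-algebra on [D], which
   need not be measurable: a simple function for the trace is the restriction
   to [D] of a simple function on the whole of [T]. *)
Definition strongly_measurable (D : set T) (X : T -> V) : Prop :=
  exists s : nat -> T -> V,
    (forall j, simple_function (s j)) /\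
    (forall t, D t -> s j t @[j --> \oo] --> X t).

Variable P : probability T R.

Definition simple_integral (s : T -> V) : V :=
  \sum_(x \in range s) fine (P (s @^-1` [set x])) *: x.

(* [X] is Bochner integrable and its Bochner integral is [x]. *)
Definition has_bochner_expectation (X : T -> V) (x : V) : Prop :=
  strongly_measurable setT X /\
  exists s : nat -> T -> V,
    [/\ forall j, simple_function (s j),
        (\int[P]_t (`|X t - s j t|)%:E)%E @[j --> \oo] --> 0%E &
        simple_integral (s j) @[j --> \oo] --> x].

End bochner.

Section random_vectors.
Context {d d' : measure_display} {T : measurableType d} {T' : measurableType d'}.
Context {R : realType} (P : probability T R).

Definition identically_distributed (X Y : {RV P >-> T'}) : Prop :=
  forall B : set T', measurable B -> distribution P X B = distribution P Y B.

Definition mutually_independent (I : eqType) (X : I -> {RV P >-> T'}) : Prop :=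
  forall (J : seq I) (B : I -> set T'),
    uniq J -> (forall i, i \in J -> measurable (B i)) ->
    P (\big[setI/setT]_(i <- J) (X i @^-1` B i)) =
    (\prod_(i <- J) P (X i @^-1` B i))%E.

End random_vectors.

Section optimization.
Context {R : realType} {U : normedModType R}.

(* The Riesz representative, for the inner product [dot], of the Frechet
   derivative of [phi] at [u]. *)
Definition is_gradient (dot : U -> U -> R) (phi : U -> R) (u G : U) : Prop :=
  differentiable phi u /\ forall h : U, 'd phi u h = dot G h.

Definition eproper (g : U -> \bar R) : Prop :=
  (forall z, g z != -oo%E) /\ exists z, g z != +oo%E.

(* At the endpoints [t = 0] and [t = 1] this relies on [0 * +oo = 0]. *)
Definition econvex (g : U -> \bar R) : Prop :=
  forall (x y : U) (t : R), 0 <= t <= 1 ->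
    (g (t *: x + (1 - t) *: y)%R <= t%:E * g x + (1 - t)%:E * g y)%E.

Definition argmin {X : Type} (D : set X) (J : X -> \bar R) : set X :=
  [set x | D x /\ forall y, D y -> (J x <= J y)%E].

End optimization.

(* [Y] is the space where the random vectors take their values, [gradF w y] the
   gradient of [F(., y)] at [w]; the batch of step [k] is indexed by ['I_(m k)]. *)
Record stochastic_admm (R : realType) (U : normedModType R) (Omega Y : Type)
    (dot : U -> U -> R) (Uad : set U) (g : U -> \bar R) (gradF : U -> Y -> U)
    (mu : R) (rho eta theta : nat -> R) (m : nat -> nat)
    (sample : forall k, 'I_(m k) -> Omega -> Y) (u0 z0 lambda0 : U)
    (u z v s psi lambda : nat -> Omega -> U) : Prop := StochasticADMM {
  admm_u0 : forall w, u 0%N w = u0;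
  admm_z0 : forall w, z 0%N w = z0;
  admm_v0 : forall w, v 0%N w = u0;
  admm_s0 : forall w, s 0%N w = z0;
  admm_psi0 : forall w, psi 0%N w = lambda0;
  admm_lambda0 : forall w, lambda 0%N w = lambda0;
  admm_s : forall k w,
    argmin setT
      (fun x : U => (g x + (dot (lambda k w) x
                            + rho k / 2 * `|x - v k w| ^+ 2)%:E)%E)
      (s k.+1 w);
  admm_v : forall k w,
    let G := (m k)%:R^-1 *: \sum_(i < m k) gradF (v k w) (sample k i w) in
    argmin Uad
      (fun x : U => (dot (G - lambda k w) x
                     + rho k / 2 * `|x - s k.+1 w| ^+ 2
                     + eta k / 2 * `|x - v k w| ^+ 2)%:E)
      (v k.+1 w);
  admm_psi : forall k w,
    psi k.+1 w = psi k w - (mu * rho k) *: (v k.+1 w - s k.+1 w);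
  admm_u : forall k w,
    u k.+1 w = (1 - (theta k)^-1) *: u k w + (theta k)^-1 *: v k.+1 w;
  admm_z : forall k w,
    z k.+1 w = (1 - (theta k)^-1) *: z k w + (theta k)^-1 *: s k.+1 w;
  admm_lambda : forall k w,
    lambda k.+1 w =
      psi k.+1 w - (mu * rho k * theta k) *: (u k.+1 w - z k.+1 w)
}.

(* Main.v *)
(* Write r_k = v_{k+1} - s_{k+1}, delta_k = G_k - grad f(v_k), y_k = v_k - us.
   The multiplier recursion collapses to lambda_{k+1} = lambda_k - 2 mu rho r_k,
   and K u_K, K z_K are the sums of the v_k, s_k. Adding the variational
   inequalities of the two subproblems to the descent inequality of f gives, for
   every l, a bound on f(v_{k+1}) + g(s_{k+1}) - f(us) - g(zs) - <l, r_k> by a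
   telescoping term plus the noise
     phi/2 |delta_k|^2 - <delta_k, y_k>
       = (|phi delta_k - y_k|^2 - |y_k|^2) / (2 phi).
   Summing, applying Jensen's inequality, and choosing l pathwise as the vector
   of norm c opposite to u_K - z_K bounds gap_K + c |u_K - z_K|, while the
   multiplier inequality gives gap_K >= - c/2 |u_K - z_K|. Both claims follow by
   taking expectations, since E|phi delta_k - y_k|^2 <= phi^2 varrho^2 / m_k +
   E|y_k|^2. That estimate is obtained sample by sample: freeze the past on the
   cells of a countable partition, use independence and unbiasedness on each
   cell, and pass to the limit with Fatou's lemma. *)

Require Import Defs.
From HB Require Import structures.
From mathcomp Require Import all_boot all_order all_algebra.
From mathcomp Require Import all_classical all_reals all_analysis.
From mathcomp Require Import measurable_realfun.
From mathcomp Require Import ring lra.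
Import Order.TTheory GRing.Theory Num.Theory numFieldNormedType.Exports.

Set Implicit Arguments.
Unset Strict Implicit.
Unset Printing Implicit Defensive.

Local Open Scope classical_set_scope.
Local Open Scope ring_scope.

(** * Inner products and one step of the algorithm *)

(** [U] may be nonseparable, and there sums of Borel maps can fail to be Borel.
    [countably_approximable] therefore replaces Borel measurability: it survives Lipschitz maps,
    pointwise limits and compositions [h (X w) w] with [h] continuous in its first argument, and it
    makes norms measurable. The iterates have it because each argmin is a Lipschitz function of its
    data. The stochastic gradient at a random point has it because a convex Frechet differentiable
    function has a continuous gradient. Asked relative to the sigma-algebra of the samples already
    drawn, the same notion expresses adaptedness, and no conditional expectation has to be formed.
    The vector [l] may be chosen separately at each outcome because the noise does not contain [l];
    the choice need not be measurable. The value of [phi] comes from Young's inequality: [1 / phi]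
    is the part of [eta] left once [L] pays for the descent inequality and [mu rho / (1 - mu)] for
    the coupling of [v] and [s]. *)

Section inner_product.
Context {R : realType} {U : normedModType R} (dot : {dot U for idfun}).
Hypothesis dot_norm : forall x : U, dot x x = `|x| ^+ 2.

Lemma dotC x y : dot x y = dot y x.
Proof. by rewrite hermC expr0 mul1r. Qed.

Lemma dotDl x y z : dot (x + y) z = dot x z + dot y z.
Proof. exact: linearDl. Qed.

Lemma dotDr x y z : dot x (y + z) = dot x y + dot x z.
Proof. exact: linearDr. Qed.

Lemma dotNl x y : dot (- x) y = - dot x y.
Proof. exact: linearNl. Qed.

Lemma dotNr x y : dot x (- y) = - dot x y.
Proof. exact: linearNr. Qed.

Lemma dotZl a x y : dot (a *: x) y = a * dot x y.
Proof. exact: linearZl_LR. Qed.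

Lemma dotZr a x y : dot x (a *: y) = a * dot x y.
Proof. by rewrite dotC dotZl dotC. Qed.

Definition dotE := (dotDl, dotDr, dotNl, dotNr, dotZl, dotZr).

Lemma dot0r x : dot x 0 = 0.
Proof. by rewrite -(scale0r x) dotZr mul0r. Qed.

Lemma dot_suml (I : Type) (r : seq I) (F : I -> U) y :
  dot (\sum_(i <- r) F i) y = \sum_(i <- r) dot (F i) y.
Proof.
elim: r => [|i r IH]; first by rewrite !big_nil dotC dot0r.
by rewrite !big_cons dotDl IH.
Qed.

(** Cauchy-Schwarz, by expanding the squared norm of [|y| x - |x| y] and dividing by [2 |x| |y|]. *)
Lemma dot_le x y : dot x y <= `|x| * `|y|.
Proof.
have [->|x0] := eqVneq x 0; first by rewrite dotC dot0r normr0 mul0r.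
have [->|y0] := eqVneq y 0; first by rewrite dot0r normr0 mulr0.
have xy0 : 0 < `|x| * `|y| by rewrite mulr_gt0 ?normr_gt0.
have : 0 <= `| `|y| *: x - `|x| *: y| ^+ 2 by rewrite exprn_ge0.
rewrite -dot_norm !dotE (dotC y x) !dot_norm => h.
rewrite -(ler_pM2l xy0); nra.
Qed.

Lemma normB2 x y : `|x - y| ^+ 2 = `|x| ^+ 2 - 2 * dot x y + `|y| ^+ 2.
Proof. by rewrite -!dot_norm !dotE (dotC y x); ring. Qed.


(** The limit [t -> 0+], with [t] confined to the weights of convex combinations. *)
Lemma le_of_le_small (a b c : R) :
  (forall t, 0 < t <= 1 -> a <= b + t * c) -> a <= b.
Proof.
move=> h; rewrite leNgt; apply/negP => ba.
have c1 : 0 < `|c| + 1 + (a - b) by have := normr_ge0 c; lra.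
(* For this [t], [t |c| = (a - b) - t (1 + (a - b)) < a - b], against the hypothesis. *)
pose t := (a - b) / (`|c| + 1 + (a - b)).
have t01 : 0 < t <= 1.
  rewrite /t divr_gt0 ?subr_gt0//= ler_pdivrMr//.
  by have := normr_ge0 c; lra.
have := h t t01; have tE : t * (`|c| + 1 + (a - b)) = a - b.
  by rewrite /t divfK// gt_eqF.
have := ler_norm c; case/andP: t01 => t0 t1.
have : 0 < t * (a - b) by rewrite mulr_gt0// subr_gt0.
move=> h1 h2 h3.
have : t * c <= t * `|c| by rewrite ler_pM2l.
lra.
Qed.

Section smooth_convex.
Context (f : U -> R) (gradf : U -> U) (L : R).
Hypothesis f_convex : forall x y, f x + dot (gradf x) (y - x) <= f y.
Hypothesis f_smooth : forall x y, `|gradf x - gradf y| <= L * `|x - y|.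

(* Telescoping the gradient inequality along a subdivision of the segment into
   [N.+1] pieces: this avoids integrating the derivative. *)
Let descent_subdivision x h (N i : nat) :
  f (x + (i%:R / N.+1%:R) *: h) <=
    f x + i%:R / N.+1%:R * dot (gradf x) h
    + L * `|h| ^+ 2 / N.+1%:R ^+ 2 * (i%:R * (i%:R + 1) / 2).
Proof.
have N0 : N.+1%:R != 0 :> R by rewrite pnatr_eq0.
elim: i => [|i IH]; first by rewrite !mul0r scale0r !addr0 mulr0 addr0.
set p := x + (i%:R / N.+1%:R) *: h in IH *.
set q := x + (i.+1%:R / N.+1%:R) *: h.
have pq : p - q = - (N.+1%:R^-1 *: h).
  suff -> : q = p + N.+1%:R^-1 *: h by rewrite opprD addNKr.
  rewrite /q /p -addrA -scalerDl; congr (_ + _ *: _).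
  by rewrite -natr1; field.
have qx : q - x = (i.+1%:R / N.+1%:R) *: h by rewrite /q addrC addKr.
have := f_convex q p; rewrite pq dotNr dotZr => fq.
have : dot (gradf q - gradf x) h <= L * (i.+1%:R / N.+1%:R) * `|h| ^+ 2.
  apply: le_trans (dot_le _ _) _.
  rewrite expr2 mulrA ler_wpM2r//; apply: le_trans (f_smooth _ _) _.
  by rewrite qx normrZ ger0_norm// mulrA.
rewrite dotDl dotNl => gq.
have iN : 0 < N.+1%:R^-1 :> R by rewrite invr_gt0 ltr0n.
rewrite -natr1 in gq *.
have := ler_wpM2l (ltW iN) gq.
set k := N.+1%:R^-1 in iN fq IH gq *; rewrite -exprVn -/k => gk.
move: IH fq gk; set I := i%:R; set A := f p; set B := f q; rewrite -exprVn -/k.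
lra.
Qed.

Lemma descent x y :
  f y <= f x + dot (gradf x) (y - x) + L / 2 * `|y - x| ^+ 2.
Proof.
set h := y - x; have yE : y = x + h by rewrite /h addrC subrK.
(* At [i = N + 1] the factor [i (i + 1) / 2] over [(N + 1)^2] equals [1/2 + 1 / (2 (N + 1))]; the
   second part is the excess to be removed. *)
have key N : f y <= f x + dot (gradf x) h + L / 2 * `|h| ^+ 2
                    + N.+1%:R^-1 * (L / 2 * `|h| ^+ 2).
  have := descent_subdivision x h N N.+1.
  have N0 : N.+1%:R != 0 :> R by rewrite pnatr_eq0.
  rewrite divff// scale1r mul1r -yE => /le_trans; apply.
  rewrite le_eqVlt; apply/orP; left; apply/eqP; move: N0; set n := N.+1%:R => ?.
  by field.
(* If [L] is negative the excess is nonpositive and one piece suffices; otherwise the subdivision is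
   refined until the excess is small. *)
have [L0|L0] := leP 0 (L / 2 * `|h| ^+ 2); last first.
  by apply: le_trans (key 0%N) _; rewrite invr1; lra.
apply: (@le_of_le_small _ _ (L / 2 * `|h| ^+ 2)) => t /andP[t0 t1].
have [N] := ltr_add_invr t0; rewrite add0r => Nt.
apply: le_trans (key N) _; rewrite lerD2l ler_wpM2r// ltW//.
Qed.

End smooth_convex.

Lemma quadratic_expand (l s v h : U) (r t : R) :
  dot l (s + t *: h) + r / 2 * `|s + t *: h - v| ^+ 2 =
  dot l s + r / 2 * `|s - v| ^+ 2
  + t * (dot (l + r *: (s - v)) h + t * (r / 2 * `|h| ^+ 2)).
Proof.
rewrite -!dot_norm !dotE (dotC h s) (dotC v s) (dotC h v).
by field.
Qed.

Lemma segmentE (x y : U) (t : R) : t *: x + (1 - t) *: y = y + t *: (x - y).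
Proof. by rewrite scalerBl scale1r scalerBr addrCA. Qed.

(** Comparing [s] with [t z + (1 - t) s], dividing by [t] and letting [t] tend to 0 removes the
    quadratic remainder. The subgradient inequality is written additively so that it keeps its
    meaning where [g z] is infinite. *)
Lemma argmin_prox (g : U -> \bar R) (l v s : U) (r : R) :
  eproper g -> econvex g ->
  argmin setT (fun x => (g x + (dot l x + r / 2 * `|x - v| ^+ 2)%:E)%E) s ->
  g s \is a fin_num /\
  forall z, (g s + (dot (l + r *: (s - v)) (s - z))%:E <= g z)%E.
Proof.
move=> [gNy [z1 gz1]] gcvx [_ smin].
have gs : g s \is a fin_num.
  rewrite fin_numE gNy/=; apply/eqP => gsy; have := smin z1 I.
  rewrite gsy addye// leye_eq => /eqP.
  by case: (g z1) (gNy z1) gz1 => //.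
split=> // z.
have := gNy z; case gzE: (g z) => [gz||]// _; last by rewrite leey.
move: gs; case gsE: (g s) => [gs'||]// _; rewrite -EFinD lee_fin.
suff : gs' - gz <= dot (l + r *: (s - v)) (z - s).
  by rewrite -(opprB s z) dotNr; lra.
apply: (@le_of_le_small _ _ (r / 2 * `|z - s| ^+ 2)) => t /andP[t0 t1].
have t01 : 0 <= t <= 1 by rewrite ltW.
have := smin (t *: z + (1 - t) *: s) I.
have := gcvx z s t t01; rewrite gsE gzE => h1 h2.
have := le_trans h2 (leeD2r _ h1); rewrite -!EFinM -!EFinD lee_fin.
by rewrite segmentE quadratic_expand => h3; rewrite -(ler_pM2l t0); lra.
Qed.

Lemma argmin_projection (A : set U) (l s v x : U) (r e : R) :
  (forall a b (t : R), A a -> A b -> 0 < t <= 1 -> A (t *: a + (1 - t) *: b)) ->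
  argmin A (fun x => (dot l x + r / 2 * `|x - s| ^+ 2
                      + e / 2 * `|x - v| ^+ 2)%:E) x ->
  A x /\
  forall y, A y -> dot (l + r *: (x - s) + e *: (x - v)) (x - y) <= 0.
Proof.
move=> cA [Ax xmin]; split=> // y Ay; rewrite -(opprB y x) dotNr oppr_le0.
apply: (@le_of_le_small _ _ ((r + e) / 2 * `|y - x| ^+ 2)) => t t01.
have := xmin _ (cA _ _ _ Ay Ax t01); case/andP: t01 => t0 t1.
rewrite lee_fin segmentE quadratic_expand.
have := quadratic_expand 0 x v (y - x) e t.
rewrite !(dotC 0) !dot0r !add0r => ->.
by rewrite !dotDl => h; rewrite -(ler_pM2l t0); lra.
Qed.

Section admm_step.
Variables (mu rho eta L phi : R).
Hypotheses (mu01 : 0 < mu < 1) (rho_gt0 : 0 < rho) (phi_gt0 : 0 < phi).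
Hypothesis phiE : phi^-1 = eta - mu * rho / (1 - mu) - L.
Variables (lam s' v v' us G gv : U) (gs gus fv fv' fus : R).
Hypothesis hs : gs + dot (lam + rho *: (s' - v)) (s' - us) <= gus.
Hypothesis hv :
  dot (G - lam + rho *: (v' - s') + eta *: (v' - v)) (v' - us) <= 0.
Hypothesis hf' : fv' <= fv + dot gv (v' - v) + L / 2 * `|v' - v| ^+ 2.
Hypothesis hf : fv + dot gv (us - v) <= fus.

(* Equal to [phi / 2 * |delta|^2 - dot delta y]; in this form only norms have to
   be shown measurable and integrable. *)
Definition admm_noise (phi : R) (delta y : U) : R :=
  (2 * phi)^-1 * (`|phi *: delta - y| ^+ 2 - `|y| ^+ 2).

(** Besides the noise and the telescoping terms, two products without sign remain:
    [<G - gv, v' - v>] and [rho <v' - v, v' - s'>]. Both are absorbed by the squares of [v' - v] and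
    [v' - s']; [phiE] allots the coefficient of [|v' - v|^2] among the descent inequality, the noise
    and the residual. *)
Lemma admm_step_le (l : U) :
  fv' + gs - fus - gus - dot l (v' - s') <=
    (rho + eta) / 2 * (`|v - us| ^+ 2 - `|v' - us| ^+ 2)
    + (4 * mu * rho)^-1
      * (`|lam - l| ^+ 2 - `|lam - (2 * mu * rho) *: (v' - s') - l| ^+ 2)
    + admm_noise phi (G - gv) (v - us).
Proof.
case/andP: mu01 => mu0 mu1.
have noiseE : admm_noise phi (G - gv) (v - us) =
    phi / 2 * `|G - gv| ^+ 2 - dot (G - gv) (v - us).
  rewrite /admm_noise normB2 normrZ dotZl exprMn gtr0_norm//.
  by field; rewrite gt_eqF.
(* The step length [2 mu rho] makes the telescoping difference equal to a linear term minus
   [mu rho |v' - s'|^2]. The penalty supplies [rho |v' - s'|^2], whence the factor [1 - mu]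
   below. *)
have dualE : (4 * mu * rho)^-1
      * (`|lam - l| ^+ 2 - `|lam - (2 * mu * rho) *: (v' - s') - l| ^+ 2)
    = dot (lam - l) (v' - s') - mu * rho * `|v' - s'| ^+ 2.
  rewrite addrAC (normB2 (lam - l)) normrZ dotZr exprMn.
  rewrite gtr0_norm ?mulr_gt0//.
  by field; rewrite !gt_eqF.
have young_noise : 0 <= phi / 2 * `|G - gv| ^+ 2 + dot (G - gv) (v' - v)
    + phi^-1 / 2 * `|v' - v| ^+ 2.
  suff -> : phi / 2 * `|G - gv| ^+ 2 + dot (G - gv) (v' - v)
      + phi^-1 / 2 * `|v' - v| ^+ 2
    = phi / 2 * `|(G - gv) - (- phi^-1) *: (v' - v)| ^+ 2.
    by rewrite mulr_ge0// divr_ge0// ltW.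
  rewrite (normB2 (G - gv)) normrZ dotZr exprMn normrN gtr0_norm ?invr_gt0//.
  by field; rewrite gt_eqF.
have mu1' : 1 - mu != 0 by rewrite subr_eq0 gt_eqF.
(* By [phiE] the last coefficient is [rho / (2 (1 - mu))], twice what completing the square
   requires. *)
have young_residual : 0 <= (1 - mu) * rho * `|v' - s'| ^+ 2
    - rho * dot (v' - v) (v' - s')
    + (rho + eta - L - phi^-1) / 2 * `|v' - v| ^+ 2.
  suff -> : (1 - mu) * rho * `|v' - s'| ^+ 2
      - rho * dot (v' - v) (v' - s')
      + (rho + eta - L - phi^-1) / 2 * `|v' - v| ^+ 2
    = (1 - mu) * rho * (`|(v' - s') - (2 * (1 - mu))^-1 *: (v' - v)| ^+ 2
        + (2 * (1 - mu))^-1 ^+ 2 * `|v' - v| ^+ 2).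
    apply: mulr_ge0; first by rewrite mulr_ge0 ?subr_ge0 ?ltW.
    apply: addr_ge0; first exact: sqr_ge0.
    by apply: mulr_ge0; exact: sqr_ge0.
  rewrite (normB2 (v' - s')) normrZ exprMn dotZr phiE (dotC (v' - s')).
  rewrite ger0_norm ?invr_ge0; last by lra.
  by field.
rewrite noiseE dualE.
move: hs hv hf hf' young_noise young_residual.
rewrite -!dot_norm; set tau := phi^-1.
rewrite !dotE.
rewrite ?(dotC s' v) ?(dotC s' v') ?(dotC v' v) ?(dotC us v) ?(dotC us v').
rewrite ?(dotC us s').
lra.
Qed.

End admm_step.

End inner_product.

(** * Measurability by countable approximation *)

Section countably_approximable.
Context {d : measure_display} {T : measurableType d} {R : realType}.

Lemma measurable_fun_nat (q : T -> nat) :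
  (forall i, measurable (q @^-1` [set i])) -> measurable_fun setT q.
Proof.
move=> mq _ B _; rewrite setTI.
have -> : q @^-1` B = \bigcup_(i in B) q @^-1` [set i].
  by apply/seteqP; split=> [w Bw|w [i Bi /= ->]//]; exists (q w).
by apply: bigcup_measurable => i _.
Qed.

(** The least admissible index works: its fibres are [A i] minus the earlier [A j]. *)
Lemma measurable_index (A : nat -> set T) :
  (forall n, measurable (A n)) -> (forall w, exists n, A n w) ->
  exists2 q : T -> nat, measurable_fun setT q & forall w, A (q w) w.
Proof.
move=> mA cA.
have cAb w : exists n, `[< A n w >] by have [n An] := cA w; exists n;
    apply/asboolP.
exists (fun w => ex_minn (cAb w)); last first.
  by move=> w; case: ex_minnP => n /asboolP.
apply: measurable_fun_nat => i.
have -> : (fun w => ex_minn (cAb w)) @^-1` [set i] =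
    A i `\` \bigcup_(j < i) A j.
  apply/seteqP; split=> [w /= <-|w [Ai /= nA]].
    case: ex_minnP => n /asboolP An nmin; split=> // -[j /= jn Aj].
    by have := nmin j; rewrite leqNgt jn => /(_ _)/negP; apply=> //;
        exact/asboolP.
  case: ex_minnP => n /asboolP An nmin; apply/eqP; rewrite eqn_leq nmin/=;
      last exact/asboolP.
  by rewrite leqNgt; apply/negP => ni; apply: nA; exists n.
by apply: measurableD => //; apply: bigcup_measurable.
Qed.

(** The fibres of [r] are a common refinement of two countable partitions. *)
Lemma measurable_pairing (p q : T -> nat) :
  measurable_fun setT p -> measurable_fun setT q ->
  exists2 r : T -> nat, measurable_fun setT r &
    forall w w', r w = r w' -> p w = p w' /\ q w = q w'.
Proof.
move=> mp mq; exists (fun w => pickle (p w, q w)); last first.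
  by move=> w w' /(pcan_inj pickleK)[].
apply: measurable_fun_nat => i.
have [[[j k] jki]|ni] := pselect (exists jk : nat * nat, pickle jk = i);
    last first.
  rewrite [X in measurable X](_ : _ = set0) ?measurable0//.
  by apply/seteqP; split=> // w /= wi; apply: ni; exists (p w, q w).
rewrite [X in measurable X](_ : _ = p @^-1` [set j] `&` q @^-1` [set k]).
  by apply: measurableI; rewrite -[X in measurable X]setTI;
      [apply: mp|apply: mq].
rewrite -jki; apply/seteqP; split=> w /=; last by move=> [-> ->].
by move=> /(pcan_inj pickleK)[].
Qed.

(* For maps into a possibly nonseparable normed space this replaces
   measurability; unlike strong measurability it passes at once from [X] to any
   [Y] that is a Lipschitz function of [X] on the range of [X]. *)
Definition countably_approximable {V : normedModType R} (X : T -> V) : Prop :=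
  forall e : R, 0 < e -> exists2 q : T -> nat, measurable_fun setT q &
    forall w w', q w = q w' -> `|X w - X w'| <= e.

Lemma approximable_lipschitz2 {V V' W : normedModType R} (C : R)
    (X : T -> V) (Y : T -> V') (Z : T -> W) :
  countably_approximable X -> countably_approximable Y ->
  (forall w w', `|Z w - Z w'| <= C * (`|X w - X w'| + `|Y w - Y w'|)) ->
  countably_approximable Z.
Proof.
move=> aX aY ZXY e e0; pose D := (`|C| + 1) * 2.
have D0 : 0 < D by rewrite /D mulr_gt0//; have := normr_ge0 C; lra.
have eD : 0 < e / D by rewrite divr_gt0.
have [p mp pX] := aX _ eD; have [q mq qY] := aY _ eD.
have [r mr rpq] := measurable_pairing mp mq.
exists r => // w w' /rpq[/pX hX /qY hY].
apply: le_trans (ZXY w w') _; apply: (@le_trans _ _ ((`|C| + 1) * (e / D + e /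
    D))).
  apply: (@le_trans _ _ ((`|C| + 1) * (`|X w - X w'| + `|Y w - Y w'|))).
    by rewrite ler_wpM2r ?addr_ge0//; have := ler_norm C; lra.
  by rewrite ler_wpM2l ?lerD// addr_ge0.
rewrite le_eqVlt; apply/orP; left; apply/eqP; rewrite /D; field.
by rewrite gt_eqF//; have := normr_ge0 C; lra.
Qed.

Lemma approximable_lipschitz {V W : normedModType R} (C : R)
    (X : T -> V) (Z : T -> W) :
  countably_approximable X ->
  (forall w w', `|Z w - Z w'| <= C * `|X w - X w'|) ->
  countably_approximable Z.
Proof.
move=> aX ZX; apply: (approximable_lipschitz2 (C := C / 2) aX aX) => w w'.
by have := ZX w w'; lra.
Qed.

Lemma approximable_cst {V : normedModType R} (x : V) :
    countably_approximable (fun _ : T => x).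
Proof. by move=> e e0; exists (fun=> 0%N) => // w w' _;
    rewrite subrr normr0 ltW. Qed.

Lemma approximableD {V : normedModType R} (X Y : T -> V) :
  countably_approximable X -> countably_approximable Y ->
  countably_approximable (fun w => X w + Y w).
Proof.
move=> aX aY; apply: (approximable_lipschitz2 (C := 1) aX aY) => w w'.
by rewrite mul1r opprD addrACA ler_normD.
Qed.

Lemma approximableZ {V : normedModType R} (a : R) (X : T -> V) :
  countably_approximable X -> countably_approximable (fun w => a *: X w).
Proof.
move=> aX; apply: (approximable_lipschitz (C := `|a|) aX) => w w'.
by rewrite -scalerBr normrZ.
Qed.

Lemma approximableN {V : normedModType R} (X : T -> V) :
  countably_approximable X -> countably_approximable (fun w => - X w).
Proof.
move=> aX; apply: (approximable_lipschitz (C := 1) aX) => w w'.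
by rewrite -opprD normrN mul1r.
Qed.

Lemma approximableB {V : normedModType R} (X Y : T -> V) :
  countably_approximable X -> countably_approximable Y ->
  countably_approximable (fun w => X w - Y w).
Proof. by move=> aX aY; apply: approximableD => //; exact: approximableN. Qed.

(** If a ball around [X w] lies in [O], so does the image of every sufficiently fine cell through
    [w]. Hence the preimage is the union of the cells it contains, over the meshes [1 / (n + 1)]: a
    countable union even when [V] has no countable base. *)
Lemma approximable_open {V : normedModType R} (X : T -> V) (O : set V) :
  countably_approximable X -> open O -> measurable (X @^-1` O).
Proof.
move=> aX oO.
have en n : 0 < n.+1%:R^-1 :> R by rewrite invr_gt0.
pose q n := projT1 (cid2 (aX _ (en n))).
have mq n : measurable_fun setT (q n) by rewrite /q; case: cid2.
have qX n w w' : q n w = q n w' -> `|X w - X w'| <= n.+1%:R^-1.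
  by rewrite /q; case: cid2 => p mp; exact.
pose good n i := q n @^-1` [set i] `<=` X @^-1` O.
have -> : X @^-1` O = \bigcup_n \bigcup_(i in [set i | good n i]) q n @^-1`
    [set i].
  apply/seteqP; split=> [w Ow|w [n _ [i gi qi]]]; last exact: gi.
  have /nbhs_ballP[e /= e0 eO] : nbhs (X w) O by exact: open_nbhs_nbhs.
  have [n ne] := ltr_add_invr e0; rewrite add0r in ne.
  exists n => //; exists (q n w) => // w' /= /esym qw.
  by apply: eO; rewrite -ball_normE/=; apply: le_lt_trans ne; exact: qX.
apply: bigcupT_measurable => n; apply: bigcup_measurable => i _.
by rewrite -[X in measurable X]setTI; apply: mq.
Qed.

Lemma approximable_measurable {V : normedModType R} (X : T -> V) (h : V -> R) :
  countably_approximable X -> continuous h ->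
  measurable_fun setT (fun w => h (X w)).
Proof.
move=> aX /continuousP ch.
apply: (measurability _ (RGenOInfty.measurableE R)).
move=> _ [_ [a ->] <-]; rewrite setTI.
by apply: (approximable_open (O := h @^-1` `]a, +oo[) aX); apply: ch;
    exact: interval_open.
Qed.

Lemma approximable_measurable_norm {V : normedModType R} (X : T -> V) :
  countably_approximable X -> measurable_fun setT (fun w => `|X w|).
Proof.
by move=> aX; apply: (approximable_measurable aX); exact: norm_continuous.
Qed.

Lemma approximable_measurable_lsc {V : normedModType R} (X : T -> V)
    (h : V -> \bar R) :
  countably_approximable X -> lower_semicontinuous h ->
  measurable_fun setT (fun w => h (X w)).
Proof.
move=> aX /lower_semicontinuousP ch.
apply: (measurability _ (ErealGenOInfty.measurableE R)).
move=> _ [_ [a ->] <-]; rewrite setTI preimage_itvoy.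
exact: (approximable_open (O := [set x | (a%:E < h x)%E]) aX).
Qed.

(** The cells of the glued map are the sets [q = j] cut by the cells of [X j], still countably many.
    This turns values frozen on cells back into random vectors. *)
Lemma approximable_glue {V : normedModType R} (q : T -> nat)
    (X : nat -> T -> V) :
  measurable_fun setT q -> (forall i, countably_approximable (X i)) ->
  countably_approximable (fun w => X (q w) w).
Proof.
move=> mq aX e e0.
pose p i := projT1 (cid2 (aX i e e0)).
have mp i : measurable_fun setT (p i) by rewrite /p; case: cid2.
have pX i w w' : p i w = p i w' -> `|X i w - X i w'| <= e.
  by rewrite /p; case: cid2 => s ms; exact.
have mpq : measurable_fun setT (fun w => p (q w) w).
  apply: measurable_fun_nat => i.
  have -> : (fun w => p (q w) w) @^-1` [set i] =
      \bigcup_j (q @^-1` [set j] `&` p j @^-1` [set i]).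
    apply/seteqP; split=> [w /= <-|w [j _ [/= -> ->]]//].
    by exists (q w).
  apply: bigcupT_measurable => j; apply: measurableI.
    by rewrite -[X in measurable X]setTI; apply: mq.
  by rewrite -[X in measurable X]setTI; apply: mp.
have [r mr rq] := measurable_pairing mq mpq.
by exists r => // w w' /rq[<-]; exact: pX.
Qed.

(** Convergence is not uniform, but the set [A n] where the sequence stays [e / 3]-close to its
    [n]-th term from [n] on is measurable. A measurable index [N w] can thus be chosen, and the
    glued map [X_ (N w) w] is uniformly close to the limit. *)
Lemma approximable_lim {V : normedModType R} (X_ : nat -> T -> V) (X : T -> V) :
  (forall n, countably_approximable (X_ n)) ->
  (forall w, X_ n w @[n --> \oo] --> X w) -> countably_approximable X.
Proof.
move=> aX cX e e0.
pose A n := \bigcap_(m in [set m | (n <= m)%N]) [set w | `|X_ m w - X_ n w| <=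
    e / 3].
have e3 : 0 < e / 3 by lra.
have mA n : measurable (A n).
  apply: bigcap_measurableType => m _.
  rewrite -[X in measurable X]setTI; apply: measurable_fun_le => //.
  by apply: approximable_measurable_norm; exact: approximableB.
have cA w : exists n, A n w.
  have /cvgrPdist_le/(_ (e / 6))[|n _ hn] := cX w; first by lra.
  exists n => m /= nm; have := hn n (leqnn n); have := hn m nm => /= h1 h2.
  by have := ler_distD (X w) (X_ m w) (X_ n w); rewrite distrC in h1; lra.
have [N mN NA] := measurable_index mA cA.
have NX w : `|X w - X_ (N w) w| <= e / 3.
  apply/ler_addgt0Pr => t t0.
  have /cvgrPdist_le/(_ t t0)[n _ hn] := cX w.
  have /= h1 := hn _ (leq_maxl n (N w)); have h2 := NA w _ (leq_maxr n (N w)).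
  move: h2 => /= h2; have := ler_distD (X_ (maxn n (N w)) w) (X w) (X_ (N w) w).
  lra.
have : countably_approximable (fun w => X_ (N w) w) by exact: approximable_glue.
move=> /(_ _ e3)[q mq qX]; exists q => // w w' /qX h.
have := NX w; have := NX w'; rewrite distrC => h1 h2.
have := ler_distD (X_ (N w) w) (X w) (X w').
have := ler_distD (X_ (N w') w') (X_ (N w) w) (X w').
lra.
Qed.

Lemma approximable_discretize {V V' : normedModType R} (X : T -> V)
    (Y : T -> V') (e : R) : 0 < e ->
  countably_approximable X -> countably_approximable Y ->
  exists (q : T -> nat) (r : nat -> T), [/\ measurable_fun setT q,
    forall w, `|X w - X (r (q w))| <= e & forall w, `|Y w - Y (r (q w))| <= e].
Proof.
move=> e0 aX aY.
have [p1 mp1 p1X] := aX _ e0; have [p2 mp2 p2Y] := aY _ e0.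
have [q mq qp] := measurable_pairing mp1 mp2.
(* [r i] is a representative of cell [i]. The default [point] serves empty cells only and is never
   reached through [r (q w)]. *)
pose r i := if pselect (exists w, q w = i) is left h then projT1 (cid h) else
    point.
have qr w : q (r (q w)) = q w.
  by rewrite /r; case: pselect => [h|[]]; [case: cid | exists w].
by exists q, r; split=> // w; have [h1 h2] := qp _ _ (esym (qr w));
    [exact: p1X|exact: p2Y].
Qed.

(** With [X] frozen at cell representatives the map is a gluing of countably many [h x]; continuity
    in the first argument then allows the mesh to shrink. *)
Lemma approximable_caratheodory {V W : normedModType R} (X : T -> V)
    (h : V -> T -> W) :
  countably_approximable X -> (forall x, countably_approximable (h x)) ->
  (forall w, continuous (h ^~ w)) ->
  countably_approximable (fun w => h (X w) w).
Proof.
move=> aX ah ch.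
have en n : 0 < n.+1%:R^-1 :> R by rewrite invr_gt0.
have /choice[q /choice[r qr]] : forall n, exists q : T ->
    nat, exists r : nat -> T,
    [/\ measurable_fun setT q,
    forall w, `|X w - X (r (q w))| <= n.+1%:R^-1 & forall w, `|X w - X (r (q
        w))| <= n.+1%:R^-1].
  by move=> n; exact: approximable_discretize.
apply: (approximable_lim (X_ := fun n w => h (X (r n (q n w))) w)) => [n|w].
  have [mq _ _] := qr n.
  exact: (approximable_glue (X := fun i => h (X (r n i))) mq).
apply: (@cvg_comp _ _ _ (fun n => X (r n (q n w))) (h ^~ w) _ (nbhs (X w))).
  apply/cvgrPdist_le => e e0; have [n ne] := ltr_add_invr e0;
      rewrite add0r in ne.
  exists n => // m /= nm; have [_ h1 _] := qr m; apply: le_trans (h1 w) _.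
  by apply: le_trans (ltW ne); rewrite lef_pV2 ?posrE// ler_nat.
exact: ch.
Qed.

End countably_approximable.

Lemma approximable_simple_comp {d d'} {T : measurableType d}
    {T' : measurableType d'} {R : realType} {V : normedModType R}
    (s : T' -> V) (y : T -> T') :
  simple_function s -> measurable_fun setT y ->
  countably_approximable (s \o y).
Proof.
move=> [/finite_seqP[r sr] ms] my e e0; exists (fun w => index (s (y w)) r).
  apply: measurable_fun_nat => i.
  have -> : (fun w => index (s (y w)) r) @^-1` [set i] =
      \bigcup_(x in [set x | x \in r /\ index x r = i]) y @^-1` (s @^-1` [set
          x]).
    apply/seteqP; split=> [w /= <-|w [x /= [_ <-] ->]//].
    exists (s (y w)) => //=; split=> //.
    by have : range s (s (y w)) by []; rewrite sr.
  have [[x [xr <-]]|nx] := pselect (exists x, x \in r /\ index x r = i);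
      last first.
    rewrite [X in measurable X](_ : _ = set0) ?measurable0//.
    by apply/seteqP; split=> // w [x h _]; apply: nx; exists x.
  have -> : [set x0 | x0 \in r /\ index x0 r = index x r] = [set x].
    apply/seteqP; split=> [z /= [zr zx]|z /= ->//].
    by rewrite -(nth_index x zr) zx nth_index.
  by rewrite bigcup_set1 -[X in measurable X]setTI; apply: my.
have sin w : s (y w) \in r by have : range s (s (y w)) by []; rewrite sr.
move=> w w' /(congr1 (nth 0 r)); rewrite !nth_index//= => ->.
by rewrite subrr normr0 ltW.
Qed.

Lemma approximable_strongly_comp {d d'} {T : measurableType d}
    {T' : measurableType d'} {R : realType} {V : normedModType R}
    (D : set T') (X : T' -> V) (y : T -> T') :
  strongly_measurable D X -> measurable_fun setT y -> (forall w, D (y w)) ->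
  countably_approximable (X \o y).
Proof.
move=> [s [ss sX]] my Dy.
apply: (approximable_lim (X_ := fun n => s n \o y)) => [n|w].
  exact: approximable_simple_comp.
exact: sX.
Qed.

Lemma sub_approximable {d d'} {T : measurableType d} {T' : measurableType d'}
    {R : realType} {V : normedModType R} (h : T -> T') (X : T' -> V) :
  measurable_fun setT h -> countably_approximable X ->
  countably_approximable (X \o h).
Proof.
move=> mh aX e /aX[q mq qX]; exists (q \o h); first exact: measurableT_comp.
by move=> w w'; exact: qX.
Qed.

(** * Gradients of convex functions *)

Section convex_gradient.
Context {R : realType} {U : normedModType R} (dot : {dot U for idfun}).
Hypothesis dot_norm : forall x : U, dot x x = `|x| ^+ 2.

Lemma is_gradient_taylor (phi : U -> R) (x G : U) (e : R) :
  is_gradient dot phi x G -> 0 < e ->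
  exists2 r : R, 0 < r & forall k, `|k| < r ->
    `|phi (x + k) - phi x - dot G k| <= e * `|k|.
Proof.
move=> [dphi phiG] e0; have /eqaddoP littleo_phi := diff_locally dphi.
have /nbhs_ballP[r /= r0 hr] := littleo_phi e e0; exists r => // k kr.
have := hr k; rewrite -ball_normE/= sub0r normrN => /(_ kr).
by rewrite -phiG/= !fctE opprD addrA [k + x]addrC.
Qed.

Lemma convex_functionE (phi : U -> R) (x h : U) (t : R) :
  convex_function (setT : set (convex_lmodType U)) phi -> 0 <= t <= 1 ->
  phi (x + t *: h) <= phi x + t * (phi (x + h) - phi x).
Proof.
move=> cphi t01.
have := cphi (Itv01 (andP t01).1 (andP t01).2) (x + h) x.
rewrite !inE => /(_ I I); rewrite convRE /conv/= /unstable.onem.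
by rewrite segmentE [x + h]addrC addrK [h + x]addrC; lra.
Qed.

(** For small [t] the Taylor error at [x + t h] is at most [t e], and convexity compares the slope
    along [t h] with the one along [h]. *)
Lemma convex_subgradient (phi : U -> R) (x G y : U) :
  convex_function (setT : set (convex_lmodType U)) phi ->
  is_gradient dot phi x G -> phi x + dot G (y - x) <= phi y.
Proof.
move=> cphi phiG; set h := y - x; have yE : y = x + h by rewrite addrC subrK.
apply/ler_addgt0Pr => e e0.
have h1 : 0 < `|h| + 1 by have := normr_ge0 h; lra.
have eh : 0 < e / (`|h| + 1) by rewrite divr_gt0.
have [r r0 hr] := is_gradient_taylor phiG eh.
pose t := Num.min 1 (r / 2 / (`|h| + 1)).
have t0 : 0 < t by rewrite /t lt_min ltr01/= !divr_gt0.
have t1 : t <= 1 by rewrite /t ge_min lexx.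
have th : `|t *: h| < r.
  rewrite normrZ gtr0_norm//; apply: (@le_lt_trans _ _ (r / 2 / (`|h| + 1) *
      `|h|)).
    by rewrite ler_wpM2r// /t ge_min lexx orbT.
  rewrite mulrAC ltr_pdivrMr//; have := normr_ge0 h; nra.
have := hr _ th; rewrite ler_norml => /andP[+ _];
    rewrite normrZ gtr0_norm// dotZr.
have t01 : 0 <= t <= 1 by rewrite ltW.
have := convex_functionE x h cphi t01; rewrite -yE => c1 c2.
rewrite -(ler_pM2l t0).
have : t * (e / (`|h| + 1) * `|h|) <= t * e.
  rewrite ler_pM2l// mulrAC ler_pdivrMr//; have := normr_ge0 h; nra.
lra.
Qed.

(** With [k = G z - G x], the tangent at [z] is tested at [z + t k], where [t |k| = r / 4]. Together
    with the tangent at [x] and the Taylor bound at [x] this gives [t |k|^2 <= e / 2 * |y|] with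
    [|y| < r / 2], that is, [|k| <= e]. *)
Lemma convex_gradient_continuous (phi : U -> R) (G : U -> U) :
  convex_function (setT : set (convex_lmodType U)) phi ->
  (forall x, is_gradient dot phi x (G x)) -> continuous G.
Proof.
move=> cphi phiG x; apply/cvgrPdist_le => e e0.
have e2 : 0 < e / 2 by lra.
have [r r0 hr] := is_gradient_taylor (phiG x) e2.
have r4 : 0 < r / 4 by lra.
near=> z.
have xz : `|x - z| < r / 4 by near: z; apply/nbhs_ballP;
    exists (r / 4) => //= z; rewrite -ball_normE.
rewrite distrC; set k := G z - G x.
have [->|k0] := eqVneq k 0; first by rewrite normr0 ltW.
have nk : 0 < `|k| by rewrite normr_gt0.
pose t := r / 4 / `|k|; have tk : t * `|k| = r / 4 by rewrite /t divfK// gt_eqF.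
have t0 : 0 < t by rewrite /t divr_gt0.
pose y := (z - x) + t *: k.
have ny : `|y| < r / 2.
  apply: le_lt_trans (ler_normD _ _) _.
  by rewrite normrZ (gtr0_norm t0) tk distrC; lra.
have := hr y; have -> : `|y| < r by lra.
move=> /(_ isT); rewrite ler_norml => /andP[_].
have := convex_subgradient (x + y) cphi (phiG z).
have -> : x + y - z = t *: k by rewrite /y addrA (addrC x) subrK addrAC subrr
    add0r.
have := convex_subgradient z cphi (phiG x).
rewrite [dot (G x) y]dotDr !dotZr => h1 h2 h3.
have : t * dot k k <= e / 2 * `|y| by rewrite {1}/k dotDl dotNl; lra.
rewrite dot_norm expr2 mulrA tk => h4.
have : e / 2 * `|y| <= e / 2 * (r / 2) by rewrite ler_wpM2l// ltW.
by move=> h5; rewrite -(ler_pM2l r4); lra.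
Unshelve. all: by end_near.
Qed.

End convex_gradient.

Lemma convex_set_segment {R : realType} {U : normedModType R} (A : set U)
    (a b : U) (t : R) :
  convex_set (A : set (convex_lmodType U)) -> A a -> A b -> 0 < t <= 1 ->
  A (t *: a + (1 - t) *: b).
Proof.
move=> cA Aa Ab /andP[/ltW t0 t1].
by have := cA a b (Itv01 t0 t1); rewrite !inE; exact.
Qed.

(** * Information generated by independent samples *)

Lemma bigsetI_seqE {T : Type} {I : eqType} (J : seq I)
    (F : I -> set T) (w : T) :
  (\big[setI/setT]_(i <- J) F i) w <-> forall i, i \in J -> F i w.
Proof.
elim: J => [|j J IH]; first by rewrite big_nil.
rewrite big_cons; split=> [[Fj /IH FJ] i|FJ].
  by rewrite inE => /orP[/eqP ->|/FJ].
by split; [apply: FJ; rewrite inE eqxx | apply/IH => i iJ; apply: FJ;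
    rewrite inE iJ orbT].
Qed.

Section independence.
Context {d d' : measure_display} {Omega : measurableType d}
  {T' : measurableType d'} {R : realType} (P : probability Omega R).
Context {I : eqType} (X : I -> {RV P >-> T'}).
Hypothesis X_indep : mutually_independent X.

Definition cylinders (S : set I) : set (set Omega) :=
  [set A | exists (J : seq I) (B : I -> set T'),
    [/\ uniq J, forall i, i \in J -> S i, forall i, measurable (B i) &
        A = \big[setI/setT]_(i <- J) (X i @^-1` B i)]].

(* The sigma-algebra on [Omega] generated by the [X i] with [S i]. *)
Definition info (S : set I) := g_sigma_algebraType (cylinders S).

Let measurable_preimage i (B : set T') :
  measurable B -> measurable (X i @^-1` B).
Proof. by move=> mB; exact: measurable_funPTI. Qed.

Lemma cylinders_measurable S : cylinders S `<=` measurable.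
Proof.
move=> _ [J [B [_ _ mB ->]]].
by apply: bigsetI_measurable => i _; exact: measurable_preimage.
Qed.

Lemma info_measurable S (A : set Omega) :
  (@measurable _ (info S)) A -> measurable A.
Proof. by apply: smallest_sub; [exact: sigma_algebra_measurable | exact:
    cylinders_measurable]. Qed.

Lemma cylinders_setI_closed S : setI_closed (cylinders S).
Proof.
move=> _ _ [J [B [_ JS mB ->]]] [J' [B' [_ J'S mB' ->]]].
(* Each family is padded with [setT] outside its own list, so that both intersections run over a
   common one. *)
exists (undup (J ++ J')), (fun i => (if i \in J then B i else setT) `&`
  (if i \in J' then B' i else setT)); split.
- exact: undup_uniq.
- by move=> i; rewrite mem_undup mem_cat => /orP[/JS|/J'S].
- by move=> i; apply: measurableI; case: ifP.
- apply/seteqP; split=> w.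
    move=> [/bigsetI_seqE h /bigsetI_seqE h']; apply/bigsetI_seqE => i _.
    by split; case: ifP => // ij; [exact: h | exact: h'].
  move=> /bigsetI_seqE h; split; apply/bigsetI_seqE => i ij;
    by have := h i; rewrite mem_undup mem_cat ij ?orbT => /(_ isT)[].
Qed.

(** For fixed [B], both sides are finite measures in [A]. They agree on [cylinders S], a generating
    class closed under intersection, by mutual independence applied to [j :: J]. *)
Lemma info_indep (S : set I) (j : I) (A : set Omega) (B : set T') :
  ~ S j -> (@measurable _ (info S)) A -> measurable B ->
  P (A `&` X j @^-1` B) = (P A * P (X j @^-1` B))%E.
Proof.
move=> Sj mA mB; set E := X j @^-1` B.
have mE : measurable E by exact: measurable_preimage.
pose c : {nonneg R} := NngNum (fine_ge0 (measure_ge0 P E)).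
have PE : P E = c%:num%:E by rewrite /= fineK// fin_num_measure.
rewrite muleC PE.
rewrite -[LHS]/(mrestr P mE A) -[RHS]/(mscale c P A).
apply: (g_sigma_algebra_measure_unique (cylinders S) _ (fun=> setT)) => //.
- exact: cylinders_measurable.
- by move=> _; exists [::], (fun=> setT); rewrite ?big_nil.
- by rewrite bigcup_const//; exists 0%N.
- exact: cylinders_setI_closed.
- move=> _ [J [B' [uJ JS mB' ->]]].
  rewrite /= /mrestr /mscale -PE.
  have jJ : j \notin J by apply/negP => /JS.
  pose B'' i := if i == j then B else B' i.
  have B''J i : i \in J -> B'' i = B' i.
    by move=> iJ; rewrite /B'' ifN//; apply: contra jJ => /eqP <-.
  have := X_indep (J := j :: J) (B := B''); rewrite /= jJ uJ => /(_ isT).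
  have B''j : B'' j = B by rewrite /B'' eqxx.
  rewrite !big_cons B''j setIC => indep.
  have mB'' i : i \in j :: J -> measurable (B'' i) by rewrite /B''; case: ifP.
  move: (indep mB''); rewrite -/E.
  have -> : \big[setI/setT]_(i <- J) X i @^-1` B'' i =
      \big[setI/setT]_(i <- J) X i @^-1` B' i.
    by rewrite big_seq [RHS]big_seq; apply: eq_bigr => i /B''J ->.
  move=> ->; rewrite (X_indep uJ) => [|i _]; last exact: mB'.
  congr (_ * _)%E; rewrite big_seq [RHS]big_seq.
  by apply: eq_bigr => i /B''J ->.
- move=> k; rewrite /= /mrestr setTI.
  by rewrite (le_lt_trans (probability_le1 _ _))// ltry.
Qed.

Lemma info_sample (S : set I) (i : I) :
  S i -> measurable_fun setT (X i : info S -> T').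
Proof.
move=> Si _ B mB; rewrite setTI; apply: sub_sigma_algebra.
exists [:: i], (fun=> B); rewrite big_seq1; split=> //.
by move=> k; rewrite inE => /eqP ->.
Qed.

Lemma info_id (S : set I) : measurable_fun setT (id : Omega -> info S).
Proof. by move=> _ A mA; rewrite setTI; exact: info_measurable mA. Qed.

Lemma info_incl (S S' : set I) :
  S `<=` S' -> measurable_fun setT (id : info S' -> info S).
Proof.
move=> SS' _ A; rewrite setTI; apply: smallest_sub.
  exact: smallest_sigma_algebra.
move=> _ [J [B [uJ JS mB ->]]]; apply: sub_sigma_algebra.
by exists J, B; split=> // i /JS/SS'.
Qed.

End independence.

(** By independence, [P] restricted to [A] and [P] scaled by [P A] have the same image under [Y]. *)
Lemma integral_indep {d d'} {Omega : measurableType d} {T' : measurableType d'}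
    {R : realType} (P : probability Omega R) (Y : {RV P >-> T'})
    (A : set Omega) (H : T' -> \bar R) :
  measurable A -> measurable_fun setT H -> (forall y, 0 <= H y)%E ->
  (forall B, measurable B -> P (A `&` Y @^-1` B) = P A * P (Y @^-1` B))%E ->
  (\int[P]_(w in A) H (Y w) = P A * \int[P]_w H (Y w))%E.
Proof.
move=> mA mH H0 indep.
pose c : {nonneg R} := NngNum (fine_ge0 (measure_ge0 P A)).
have PA : P A = c%:num%:E by rewrite /= fineK// fin_num_measure.
have mHY : measurable_fun setT (H \o Y) by exact: measurableT_comp.
have -> : (\int[P]_(w in A) H (Y w) = \int[mrestr P mA]_w H (Y w))%E.
  rewrite -(setUv A) ge0_integral_setU//.
  - rewrite [X in (_ = _ + X)%E](eq_measure_integral mzero); last first.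
      by move=> B mB BA; rewrite /= /mrestr /mzero setIC (_ : _ `&` _ = set0)//;
        apply/seteqP; split=> // w [Aw /BA].
    rewrite integral_measure_zero adde0; apply: eq_measure_integral => B mB BA.
    by rewrite /= /mrestr setIidl.
  - exact: measurableC.
  - by rewrite setUv.
  - by apply/disj_set2P; rewrite setICr.
have mY : measurable_fun setT Y by [].
have push (mu : {measure set Omega -> \bar R}) :
    (\int[mu]_w H (Y w) = \int[pushforward mu Y]_y H y)%E.
  by rewrite (ge0_integral_pushforward mY).
rewrite PA -(@ge0_integral_mscale _ _ _ P setT measurableT c (H \o Y) mHY (fun
    w _ => H0 (Y w))).
rewrite (push (mrestr P mA)) (push (mscale c P)).
apply: eq_measure_integral => B mB _.
by rewrite /= /pushforward /mrestr /mscale/= setIC indep// PA.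
Qed.

(** * Moments of Bochner integrable vectors *)

(** [D] need not be measurable, so [h (G y)] is replaced by an upper limit of simple functions,
    measurable everywhere; the absolute value keeps it nonnegative off [D]. *)
Lemma strongly_measurable_extension {d'} {T' : measurableType d'}
    {R : realType} {V : normedModType R} (D : set T') (G : T' -> V)
    (h : V -> R) :
  strongly_measurable D G -> continuous h -> (forall x, 0 <= h x) ->
  exists H : T' -> \bar R, [/\ measurable_fun setT H,
    forall y, (0 <= H y)%E & forall y, D y -> H y = (h (G y))%:E].
Proof.
move=> [s [ss sG]] ch h0.
exists (fun y => `|limn_esup (fun j => (h (s j y))%:E)|)%E; split=> // [|y Dy].
  apply: measurableT_comp => //; apply: measurable_fun_limn_esup => j.
  apply/measurable_EFinP; apply: (approximable_measurable (X := s j)) => //.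
  exact: (@approximable_simple_comp _ _ _ _ _ _ (s j) id).
have : (h (s j y))%:E @[j --> \oo] --> (h (G y))%:E.
  apply/fine_cvgP; split; first exact: nearW.
  by apply: (@cvg_comp _ _ _ (s ^~ y) h); [exact: sG | exact: ch].
by move=> /cvg_limn_einf_sup[_ ->]; rewrite gee0_abs// lee_fin.
Qed.

Section bochner_moments.
Context {R : realType} {U : normedModType R} (dot : {dot U for idfun}).
Hypothesis dot_norm : forall x : U, dot x x = `|x| ^+ 2.
Context {d : measure_display} {Omega : measurableType d}
  (P : probability Omega R).

Lemma dot_abs (x y : U) : `|dot x y| <= `|x| * `|y|.
Proof.
rewrite ler_norml dot_le// andbT lerNl -dotNl.
by apply: le_trans (dot_le _ _ _) _ => //; rewrite normrN.
Qed.

Lemma dot_continuous (y : U) : continuous (dot ^~ y).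
Proof.
move=> x; apply/cvgrPdist_le => e e0.
have y1 : 0 < `|y| + 1 by have := normr_ge0 y; lra.
near=> z.
have xz : `|x - z| < e / (`|y| + 1).
  near: z; apply/nbhs_ballP; exists (e / (`|y| + 1)) => /=;
      first by rewrite divr_gt0.
  by move=> z; rewrite -ball_normE.
rewrite -dotNl -dotDl; apply: le_trans (dot_abs _ _) _.
move: xz; rewrite ltr_pdivlMr//; have := normr_ge0 (x - z);
    have := normr_ge0 y; nra.
Unshelve. all: by end_near.
Qed.

Lemma simple_integral_dot (s : Omega -> U) (y : U) : simple_function s ->
  P.-integrable setT (fun w => (dot (s w) y)%:E) /\
  (\int[P]_w (dot (s w) y)%:E = (dot (simple_integral P s) y)%:E)%E.
Proof.
move=> [/finite_seqP[r sr] ms]; set u := undup r.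
have su : range s = [set` u].
  by rewrite sr; apply/seteqP; split=> x /=; rewrite mem_undup.
pose F x w := ((dot x y)%:E * (\1_(s @^-1` [set x]) w)%:E)%E.
have intF x : P.-integrable setT (F x).
  by apply: integrableZl => //; exact: integrable_indic.
have sE w : (dot (s w) y)%:E = (\sum_(x <- u) F x w)%E.
  have sw : s w \in u by have : range s (s w) by []; rewrite su.
  rewrite (bigD1_seq (s w)) ?undup_uniq//= big1 ?adde0 => [|x xw].
    by rewrite /F indicE mem_set// mule1.
  rewrite /F indicE memNset ?mule0//= => swx.
  by rewrite -swx eqxx in xw.
rewrite (_ : (fun w => _) = fun w => (\sum_(x <- u) F x w)%E);
    last exact/funext.
split; first by apply: integrable_sum.
rewrite integral_sum// /simple_integral su -fsbig_seq ?undup_uniq//.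
rewrite dot_suml -sumEFin; apply: eq_bigr => x _.
rewrite dotZl integralZl//; last exact: integrable_indic.
by rewrite integral_indic// setIT EFinM fineK ?fin_num_measure// muleC.
Qed.

(** True for simple functions by linearity; Cauchy-Schwarz bounds the error by [|y|] times the L1
    distance from [X] to [s j]. *)
Lemma bochner_dot (X : Omega -> U) (x y : U) : has_bochner_expectation P X x ->
  P.-integrable setT (fun w => (dot (X w) y)%:E) /\
  (\int[P]_w (dot (X w) y)%:E = (dot x y)%:E)%E.
Proof.
move=> [smX [s [ss sX sx]]].
have aX : countably_approximable X.
  exact: (@approximable_strongly_comp _ _ _ _ _ _ setT X id).
have as_ j : countably_approximable (s j).
  exact: (@approximable_simple_comp _ _ _ _ _ _ (s j) id).
have mXs j : measurable_fun setT (fun w => (`|X w - s j w|)%:E).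
  apply/measurable_EFinP; apply: approximable_measurable_norm.
  exact: approximableB.
have dominated j w : (`|(dot (X w - s j w) y)%:E| <= `|y|%:E * `|X w - s j
    w|%:E)%E.
  by rewrite abse_EFin -EFinM lee_fin mulrC dot_abs.
pose e j := (\int[P]_w (`|X w - s j w|)%:E)%E.
(* Convergence of [e] to 0 makes [e j] finite only from some index on, hence the guard. *)
have key j : (e j < +oo)%E ->
  P.-integrable setT (fun w => (dot (X w) y)%:E) /\
  (`|\int[P]_w (dot (X w) y)%:E - (dot (simple_integral P (s j)) y)%:E|
    <= `|y|%:E * e j)%E.
  move=> ej.
  have [is_ Is] := simple_integral_dot y (ss j).
  have md : measurable_fun setT (fun w => (dot (X w - s j w) y)%:E).
    apply/measurable_EFinP; apply: (approximable_measurable (h := dot ^~ y)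
        (X := fun w => X w - s j w)).
      exact: approximableB.
    exact: dot_continuous.
  have ie : P.-integrable setT (fun w => (`|X w - s j w|)%:E).
    by apply/integrableP; split=> //;
        under eq_integral do rewrite abse_EFin normr_id.
  have id_ : P.-integrable setT (fun w => (dot (X w - s j w) y)%:E).
    apply: (le_integrable measurableT md _ (integrableZl measurableT `|y| ie)).
    by move=> w _; rewrite [leRHS]gee0_abs ?mule_ge0// lee_fin.
  have XE : (fun w => (dot (X w) y)%:E) =
      ((fun w => (dot (X w - s j w) y)%:E) \+ (fun w => (dot (s j w) y)%:E))%E.
    by apply/funext => w; rewrite -EFinD -dotDl subrK.
  split; first by rewrite XE; exact: integrableD.
  rewrite XE integralD// Is addeK//.
  apply: le_trans (le_abse_integral _ _ md) _ => //.
  rewrite -ge0_integralZl//; apply: ge0_le_integral => //.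
    exact: measurableT_comp.
  exact: measurable_funeM.
have e_small t : 0 < t -> \forall j \near \oo, (e j <= t%:E)%E.
  move=> t0; have := sX => /fine_cvgP[fin /cvgrPdist_le/(_ t t0) et].
  near=> j; have ejf : e j \is a fin_num by near: j.
  rewrite -(fineK ejf) lee_fin; have : `|0 - fine (e j)| <= t by near: j.
  by rewrite sub0r normrN => /(le_trans (ler_norm _)).
have [j0 _ ej0] := e_small 1 ltr01.
have [intX _] := key j0 (le_lt_trans (ej0 j0 (leqnn _)) (ltry _)).
split=> //; have finX := integrable_fin_num measurableT intX.
rewrite -(fineK finX); congr (_%:E); set a := fine _.
apply/eqP; rewrite -subr_eq0 -normr_le0; apply/ler_addgt0Pr => t t0;
    rewrite add0r.
have y1 : 0 < `|y| + 1 by have := normr_ge0 y; lra.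
pose t' := t / 2 / (`|y| + 1); have t'0 : 0 < t' by rewrite /t' !divr_gt0.
have t'y : t' * (`|y| + 1) = t / 2 by rewrite /t' divfK// gt_eqF.
have [j1 _ ej] := e_small t' t'0.
have /cvgrPdist_le/(_ t' t'0)[j2 _ sj] := sx.
pose j := maxn j1 j2.
have hj : (e j <= t'%:E)%E by apply: ej; exact: leq_maxl.
have := sj j (leq_maxr _ _) => /= hs.
have [_] := key j (le_lt_trans hj (ltry _)).
rewrite -(fineK finX) -/a -EFinB abse_EFin => ka.
have : `|a - dot (simple_integral P (s j)) y| <= `|y| * t'.
  rewrite -lee_fin; apply: le_trans ka _; rewrite EFinM.
  by apply: lee_wpmul2l hj; rewrite lee_fin.
have : `|dot (simple_integral P (s j)) y - dot x y| <= t' * `|y|.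
  rewrite -dotNl -dotDl; apply: le_trans (dot_abs _ _) _.
  by rewrite ler_wpM2r// distrC.
have := ler_distD (dot (simple_integral P (s j)) y) a (dot x y).
lra.
Unshelve. all: by end_near.
Qed.

(** In the expansion of the square the cross term [2 t <X - x, y>] has mean zero. [f2] and [f3]
    split it into its random and its constant part. *)
Lemma second_moment_affine (X : Omega -> U) (x y : U) (t c : R) :
  has_bochner_expectation P X x ->
  (\int[P]_w (`|X w - x| ^+ 2)%:E <= c%:E)%E ->
  (\int[P]_w (`|t *: (X w - x) + y| ^+ 2)%:E <= (t ^+ 2 * c + `|y| ^+ 2)%:E)%E.
Proof.
move=> bX Xc; have [intXy IXy] := bochner_dot y bX.
have aX : countably_approximable X.
  by case: bX => smX _; exact: (@approximable_strongly_comp _ _ _ _ _ _ setT X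
      id).
have mX2 : measurable_fun setT (fun w => (`|X w - x| ^+ 2)%:E).
  apply/measurable_EFinP; apply: measurable_funX.
  apply: approximable_measurable_norm; apply: approximableB => //.
  exact: approximable_cst.
have iX2 : P.-integrable setT (fun w => (`|X w - x| ^+ 2)%:E).
  apply/integrableP; split=> //; under eq_integral do rewrite abse_EFin
      ger0_norm//.
  by apply: le_lt_trans Xc _; rewrite ltry.
pose f1 w := ((t ^+ 2)%:E * (`|X w - x| ^+ 2)%:E)%E.
pose f2 w := ((2 * t)%:E * (dot (X w) y)%:E)%E.
pose f3 := cst (`|y| ^+ 2 - 2 * t * dot x y)%:E : Omega -> \bar R.
have -> : (fun w => (`|t *: (X w - x) + y| ^+ 2)%:E) = ((f1 \+ f2) \+ f3)%E.
  apply/funext => w; rewrite /f1 /f2 /f3 /cst -!EFinM -!EFinD; congr (_%:E).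
  rewrite -[y in LHS]opprK (normB2 dot_norm) normrN normrZ exprMn real_normK
      ?num_real//.
  by rewrite dotNr dotZl dotDl dotNl; ring.
have if1 : P.-integrable setT f1 by exact: integrableZl.
have if2 : P.-integrable setT f2 by exact: integrableZl.
have if3 : P.-integrable setT f3 by exact: finite_measure_integrable_cst.
have If3 : (\int[P]_w f3 w = (`|y| ^+ 2 - 2 * t * dot x y)%:E)%E.
  by rewrite integral_cst// -[RHS]mule1; congr (_ * _)%E;
      exact: probability_setT.
rewrite integralD//; last exact: integrableD.
rewrite integralD// If3.
rewrite /f1 /f2 !integralZl// IXy -EFinM -addeA -EFinD.
rewrite (_ : 2 * t * dot x y + _ = `|y| ^+ 2); last by ring.
rewrite EFinD [(t ^+ 2 * c)%:E]EFinM; apply: leeD2r.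
by apply: lee_wpmul2l => //; rewrite lee_fin sqr_ge0.
Qed.

End bochner_moments.

(** * Adding one fresh sample *)

Lemma fatou_le {d} {T : measurableType d} {R : realType}
    (mu : {measure set T -> \bar R}) (h_ : nat -> T -> \bar R)
    (h : T -> \bar R) (B : \bar R) :
  (forall n, measurable_fun setT (h_ n)) -> (forall n w, 0 <= h_ n w)%E ->
  (forall w, h_ n w @[n --> \oo] --> h w) ->
  (forall n, \int[mu]_w h_ n w <= B)%E -> (\int[mu]_w h w <= B)%E.
Proof.
move=> mh h0 hh hB.
have -> : (\int[mu]_w h w = \int[mu]_w limn_einf (h_ ^~ w))%E.
  by apply: eq_integral => w _; rewrite (cvg_limn_einf_sup (hh w)).1.
apply: le_trans (fatou mu measurableT mh _) _; first by move=> n w _; exact: h0.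
rewrite limn_einf_lim; apply: lime_le; first exact: is_cvg_einfs.
apply: nearW => n; apply: le_trans (hB n).
by apply: ereal_inf_lbound; exists n => /=.
Qed.

Section one_step.
Context {R : realType} {U : normedModType R} (dot : {dot U for idfun}).
Hypothesis dot_norm : forall x : U, dot x x = `|x| ^+ 2.
Context {d d' : measure_display} {Omega : measurableType d}
  {T' : measurableType d'} (P : probability Omega R).
Context {I : eqType} (sample : I -> {RV P >-> T'}) (xi : {RV P >-> T'}).
Context (Xi : set T').
Hypotheses (xi_Xi : forall w, Xi (xi w))
  (sample_Xi : forall i w, Xi (sample i w)).
Hypothesis sample_distr : forall i, identically_distributed (sample i) xi.
Hypothesis sample_indep : mutually_independent sample.
Context (G : U -> T' -> U) (m : U -> U) (c : R).
Hypothesis c_ge0 : 0 <= c.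
Hypothesis G_measurable : forall x, strongly_measurable Xi (G x).
Hypothesis G_continuous : forall y, Xi y -> continuous (G ^~ y).
Hypothesis m_continuous : continuous m.
Hypothesis G_unbiased : forall x,
  has_bochner_expectation P (fun w => G x (xi w)) (m x).
Hypothesis G_variance : forall x,
  (\int[P]_w (`|G x (xi w) - m x| ^+ 2)%:E <= c%:E)%E.

Let err (i : I) (x : U) (w : Omega) : U := G x (sample i w) - m x.

Let affine_continuous (t : R) (x y : U) :
  continuous (fun v : U => `|t *: (v - x) + y| ^+ 2).
Proof.
move=> v; apply: cvgM; apply: cvg_norm; apply: cvgD; try exact: cvg_cst;
  by apply: cvgZr; apply: cvgB; [exact: cvg_id | exact: cvg_cst].
Qed.

(** With [x] and [y] fixed, the integrand depends on sample [j] alone, which is independent of [A];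
    its law may then be replaced by that of [xi]. *)
Lemma frozen_second_moment (S : set I) (j : I) (A : set Omega) (t : R)
    (x y : U) :
  ~ S j -> (@measurable _ (info sample S)) A ->
  (\int[P]_(w in A) (`|t *: err j x w + y| ^+ 2)%:E
     <= P A * (t ^+ 2 * c + `|y| ^+ 2)%:E)%E.
Proof.
move=> Sj mA.
have [H [mH H0 HE]] := strongly_measurable_extension (G_measurable x)
  (@affine_continuous t (m x) y) (fun v => sqr_ge0 _).
have -> : (\int[P]_(w in A) (`|t *: err j x w + y| ^+ 2)%:E
    = \int[P]_(w in A) H (sample j w))%E.
  by apply: eq_integral => w _; rewrite HE.
rewrite (integral_indep (info_measurable mA))//; last first.
  by move=> B mB; exact: (info_indep sample_indep Sj).
apply: lee_wpmul2l => //.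
have -> : (\int[P]_w H (sample j w) = \int[P]_w H (xi w))%E.
  rewrite -(ge0_integral_distribution (sample j) mH H0).
  rewrite -(ge0_integral_distribution xi mH H0).
  by apply: eq_measure_integral => B mB _; exact: sample_distr.
rewrite (eq_integral (fun w => (`|t *: (G x (xi w) - m x) + y| ^+ 2)%:E));
    last first.
  by move=> w _; rewrite HE.
exact: second_moment_affine (G_unbiased x) (G_variance x).
Qed.

(** Once sample [j] belongs to [S], its error at an [S]-known point is [S]-known, so it can join the
    past of the next sample. *)
Lemma approximable_err (S : set I) (j : I) (V : info sample S -> U) :
  S j -> countably_approximable V ->
  countably_approximable (fun w : info sample S => err j (V w) w).
Proof.
move=> Sj aV; apply: (@approximable_caratheodory _ (info sample S) R U U V
    (fun x w => err j x w)) => //.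
  move=> x; apply: approximableB; last exact: approximable_cst.
  apply: (approximable_strongly_comp (X := G x)) (G_measurable x) _ _ => //.
  exact: info_sample.
move=> w x; apply: cvgB; last exact: m_continuous.
exact: (G_continuous (sample_Xi j w)).
Qed.

(* [Y] will absorb the errors of the samples of the batch already processed. *)
Lemma one_step (S : set I) (j : I) (V Y : info sample S -> U) (t : R) :
  ~ S j -> countably_approximable V -> countably_approximable Y ->
  (\int[P]_w (`|t *: err j (V w) w + Y w| ^+ 2)%:E
     <= (t ^+ 2 * c)%:E + \int[P]_w (`|Y w| ^+ 2)%:E)%E.
Proof.
move=> Sj aV aY.
have aY' : @countably_approximable _ Omega _ _ Y.
  exact: (sub_approximable (@info_id _ _ _ _ _ P I sample S) aY).
have mY2 : measurable_fun setT (fun w : Omega => (`|Y w| ^+ 2)%:E).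
  apply/measurable_EFinP; apply: measurable_funX.
  exact: approximable_measurable_norm.
have [Yoo|Yoo] := eqVneq (\int[P]_w (`|Y w| ^+ 2)%:E)%E +oo%E.
  by rewrite Yoo addey// leey.
have Y2_ge0 : (0 <= \int[P]_w (`|Y w| ^+ 2)%:E)%E.
  by apply: integral_ge0 => w _; rewrite lee_fin sqr_ge0.
have : (\int[P]_w (`|Y w| ^+ 2)%:E)%E \is a fin_num.
  by rewrite ge0_fin_numE// ltey.
move=> /fineK; set b := fine _ => Yb.
have b0 : 0 <= b by rewrite fine_ge0.
rewrite -Yb -EFinD; apply/lee_addgt0Pr => D D0.
(* Freezing [Y] up to [e <= 1] costs [(|Y| + e)^2 <= (1 + e) |Y|^2 + 2 e], in expectation an excess
   [e (b + 2)]; the mesh keeps this below [D]. *)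
pose e n : R := Num.min 1 (D / (b + 2)) / n.+1%:R.
have e0 n : 0 < e n by rewrite /e divr_gt0// lt_min ltr01/= divr_gt0//; lra.
have eD n : e n <= D / (b + 2).
  rewrite /e ler_pdivrMr//; apply: (@le_trans _ _ (D / (b + 2))).
    by rewrite ge_min lexx orbT.
  by rewrite ler_peMr ?ler1n// divr_ge0//; lra.
have e1 n : e n <= 1.
  rewrite /e ler_pdivrMr// mul1r; apply: (@le_trans _ _ 1);
      last by rewrite ler1n.
  by rewrite ge_min lexx.
have e_cvg : e n @[n --> \oo] --> (0 : R).
  rewrite -(mulr0 (Num.min 1 (D / (b + 2)))); apply: cvgMr.
  exact: cvg_harmonic.
have /choice[q /choice[r qr]] : forall n, exists q : info sample S -> nat,
    exists r : nat -> info sample S, [/\ measurable_fun setT q,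
      forall w, `|V w - V (r (q w))| <= e n & forall w, `|Y w - Y (r (q w))|
          <= e n].
  by move=> n; exact: approximable_discretize.
pose W_ n (w : Omega) := t *: err j (V (r n (q n w))) w + Y (r n (q n w)).
have mq n : @measurable_fun _ _ Omega nat setT (q n).
  have [mq _ _] := qr n.
  exact: (measurableT_comp mq (@info_id _ _ _ _ _ P I sample S)).
have aerr x : @countably_approximable _ Omega _ _ (err j x).
  apply: approximableB; last exact: approximable_cst.
  by apply: (approximable_strongly_comp (X := G x)) (G_measurable x) _ _.
have aW n : @countably_approximable _ Omega _ _ (W_ n).
  apply: (approximable_glue (X := fun i w => t *: err j (V (r n i)) w + Y (r n
      i)) (mq n)) => i.
  by apply: approximableD; [exact: approximableZ | exact: approximable_cst].
have mW n : measurable_fun setT (fun w : Omega => (`|W_ n w| ^+ 2)%:E).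
  apply/measurable_EFinP; apply: measurable_funX.
  exact: approximable_measurable_norm (aW n).
apply: (fatou_le (h_ := fun n w => (`|W_ n w| ^+ 2)%:E)) => //.
- move=> w; apply/fine_cvgP; split; first exact: nearW.
  have close (X : Omega -> U) : (forall n, `|X w - X (r n (q n w))| <= e n) ->
      X (r n (q n w)) @[n --> \oo] --> X w.
    move=> Xe; apply/cvgrPdist_le => D' D'0.
    move/cvgrPdist_le : e_cvg => /(_ D' D'0) [N _ eN]; exists N => // n Nn.
    apply: le_trans (Xe n) _; apply: le_trans (eN n Nn).
    by rewrite sub0r normrN ler_norm.
  have Vw : V (r n (q n w)) @[n --> \oo] --> V w.
    by apply: (close V) => n; have [_ h _] := qr n.
  have Yw : Y (r n (q n w)) @[n --> \oo] --> Y w.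
    by apply: (close Y) => n; have [_ _ h] := qr n.
  have Ww : W_ n w @[n --> \oo] --> t *: err j (V w) w + Y w.
    apply: cvgD => //; apply: cvgZr; apply: cvgB.
      by apply: (@cvg_comp _ _ _ (fun n => V (r n (q n w)))
          (G ^~ (sample j w)));
        [exact: Vw | exact: G_continuous].
    by apply: (@cvg_comp _ _ _ (fun n => V (r n (q n w))) m);
      [exact: Vw | exact: m_continuous].
  by apply: (@cvgM _ _ _ _ (fun n => `|W_ n w|) (fun n => `|W_ n w|));
      apply: cvg_norm; exact: Ww.
move=> n; have [mqn qV qY] := qr n.
(* The cells lie in [info sample S], hence are independent of sample [j], and on each of them [V]
   and [Y] are replaced by constants. *)
pose A i : set Omega := q n @^-1` [set i].
have mA i : (@measurable _ (info sample S)) (A i).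
  by rewrite -[A i]setTI; apply: mqn.
have mA' i : measurable (A i) by exact: info_measurable (mA i).
have tA : trivIset setT A.
  apply/trivIsetP => i k _ _ ik; apply/seteqP; split=> // w [/= qi qk].
    by move: ik; rewrite -qi -qk eqxx.
have cA : \bigcup_i A i = setT.
  by apply/seteqP; split=> // w _; exists (q n w).
have split_int (h : Omega -> \bar R) : measurable_fun setT h ->
    (forall w, 0 <= h w)%E ->
    (\int[P]_w h w = \sum_(i <oo) \int[P]_(w in A i) h w)%E.
  move=> mh h0; rewrite -cA ge0_integral_bigcup//; first by rewrite cA.
have mYn : measurable_fun setT (fun w :
    Omega => (t ^+ 2 * c + `|Y (r n (q n w))| ^+ 2)%:E).
  apply/measurable_EFinP; apply: measurable_funD => //; apply: measurable_funX.
  apply: approximable_measurable_norm.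
  apply: (approximable_glue (X := fun i _ => Y (r n i)) (mq n)) => i.
  exact: approximable_cst.
have tc0 : 0 <= t ^+ 2 * c by rewrite mulr_ge0 ?sqr_ge0.
apply: (@le_trans _ _ (\int[P]_w (t ^+ 2 * c + `|Y (r n (q n w))| ^+ 2)%:E)%E).
  rewrite !split_int//; last first.
    by move=> w; rewrite lee_fin addr_ge0 ?sqr_ge0.
  apply: lee_nneseries => [i _ _|i _].
    by apply: integral_ge0 => w _; rewrite lee_fin sqr_ge0.
  have -> : (\int[P]_(w in A i) (`|W_ n w| ^+ 2)%:E =
      \int[P]_(w in A i) (`|t *: err j (V (r n i)) w + Y (r n i)| ^+ 2)%:E)%E.
    by apply: eq_integral => w /[!inE] /= qw; rewrite /W_ qw.
  have -> : (\int[P]_(w in A i) (t ^+ 2 * c + `|Y (r n (q n w))| ^+ 2)%:E =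
      \int[P]_(w in A i) (cst (t ^+ 2 * c + `|Y (r n i)| ^+ 2)%:E w))%E.
    by apply: eq_integral => w /[!inE] /= qw; rewrite qw.
  rewrite integral_cst// muleC.
  exact: (frozen_second_moment _ _ _ Sj).
apply: (@le_trans _ _ (\int[P]_w ((t ^+ 2 * c + 2 * e n)%:E
    + (1 + e n)%:E * (`|Y w| ^+ 2)%:E))%E).
  apply: ge0_le_integral => //.
  - by move=> w _; rewrite lee_fin addr_ge0 ?sqr_ge0.
  - by apply: emeasurable_funD => //; exact: measurable_funeM.
  - move=> w _; rewrite -EFinM -EFinD lee_fin.
    have : `|Y (r n (q n w))| <= `|Y w| + e n.
      rewrite -{1}(subKr (Y w) (Y _)); apply: le_trans (ler_normB _ _) _.
      by rewrite lerD2l.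
    have := e0 n; have := e1 n; have := normr_ge0 (Y (r n (q n w))).
    have : 0 <= e n * (`|Y w| - 1) ^+ 2 by rewrite mulr_ge0 ?sqr_ge0 ?ltW.
    nra.
have e1' : 0 <= 1 + e n by have := e0 n; lra.
rewrite ge0_integralD//; last first.
- exact: measurable_funeM.
- by move=> w _; rewrite mule_ge0// lee_fin ?sqr_ge0.
- by move=> w _; rewrite lee_fin; have := e0 n; lra.
rewrite ge0_integralZl// -Yb.
have -> : (\int[P]_w (t ^+ 2 * c + 2 * e n)%:E = (t ^+ 2 * c + 2 * e n)%:E)%E.
  by rewrite integral_cst// -[RHS]mule1; congr (_ * _)%E;
      exact: probability_setT.
rewrite -EFinM -!EFinD lee_fin.
have := eD n; rewrite ler_pdivlMr; last by lra.
have := e0 n.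
lra.
Qed.

End one_step.

(** * Batches and square integrability *)

Lemma approximable_info_incl {R : realType} {U : normedModType R}
    {d d'} {Omega : measurableType d} {T' : measurableType d'}
    (P : probability Omega R) {I : eqType} (X : I -> {RV P >-> T'})
    (S S' : set I) (V : Omega -> U) :
  S `<=` S' -> @countably_approximable _ (info X S) _ _ V ->
  @countably_approximable _ (info X S') _ _ V.
Proof.
move=> SS' aV.
exact: (sub_approximable (@info_incl _ _ _ _ _ P I X S S' SS') aV).
Qed.

Section batch.
Context {R : realType} {U : normedModType R} (dot : {dot U for idfun}).
Hypothesis dot_norm : forall x : U, dot x x = `|x| ^+ 2.
Context {d d' : measure_display} {Omega : measurableType d}
  {T' : measurableType d'} (P : probability Omega R).
Context (m : nat -> nat).
Context (sample : forall k, 'I_(m k) -> {RV P >-> T'}) (xi : {RV P >-> T'}).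
Context (Xi : set T').
Hypotheses (xi_Xi : forall w, Xi (xi w))
  (sample_Xi : forall k (i : 'I_(m k)) w, Xi (sample i w)).
Hypothesis sample_distr : forall k (i :
    'I_(m k)), identically_distributed (sample i) xi.
Local Notation I := {k : nat & 'I_(m k)}.
Let sample' (j : I) := sample (tagged j).
Hypothesis sample_indep : mutually_independent sample'.
Context (G : U -> T' -> U) (g : U -> U) (c : R).
Hypothesis c_ge0 : 0 <= c.
Hypothesis G_measurable : forall x, strongly_measurable Xi (G x).
Hypothesis G_continuous : forall y, Xi y -> continuous (G ^~ y).
Hypothesis g_continuous : continuous g.
Hypothesis G_unbiased : forall x,
  has_bochner_expectation P (fun w => G x (xi w)) (g x).
Hypothesis G_variance : forall x,
  (\int[P]_w (`|G x (xi w) - g x| ^+ 2)%:E <= c%:E)%E.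

(* The samples of the steps before [k] and the first [n] samples of step [k]. *)
Definition past (k n : nat) : set I :=
  [set j | (tag j < k)%N \/ tag j = k /\ (nat_of_ord (tagged j) < n)%N].

(** [past k 0] holds exactly the samples of the earlier steps: this is what is known when step [k]
    begins. *)
Definition adapted (k : nat) (V : Omega -> U) : Prop :=
  @countably_approximable _ (info sample' (past k 0)) _ _ V.

Definition batch_error (k : nat) (V : Omega -> U) (w : Omega) : U :=
  (m k)%:R^-1 *: (\sum_(i < m k) G (V w) (sample i w)) - g (V w).

Lemma adaptedS (k n : nat) (V : Omega -> U) :
  @countably_approximable _ (info sample' (past k n)) _ _ V -> adapted k.+1 V.
Proof.
apply: approximable_info_incl => j [jk|[jk _]]; left => /=; first exact: ltnW.
by rewrite jk.
Qed.

Lemma adapted_approximable (k : nat) (V : Omega -> U) :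
  adapted k V -> countably_approximable V.
Proof.
move=> aV; exact: (sub_approximable (@info_id _ _ _ _ _ P I sample' (past k
    0)) aV).
Qed.

Let partial (t : R) (k n : nat) (V Y : Omega -> U) (w : Omega) : U :=
  \sum_(i < m k | (i < n)%N) t *: (G (V w) (sample i w) - g (V w)) + Y w.

Let partialS t k n V Y (h : (n < m k)%N) w :
  partial t k n.+1 V Y w =
  t *: (G (V w) (sample (Ordinal h) w) - g (V w)) + partial t k n V Y w.
Proof.
rewrite /partial (bigD1 (Ordinal h))//= -addrA; congr (_ + (_ + _)).
by apply: eq_bigl => i; rewrite ltnS [RHS]ltn_neqAle -val_eqE /= andbC.
Qed.

(** Induction on the samples: the sum of the first [n] errors plus [Y] is known before sample [n]
    and takes the role of [Y] in [one_step]. *)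
Let partial_moment t k n V Y : (n <= m k)%N -> adapted k V -> adapted k Y ->
  @countably_approximable _ (info sample' (past k n)) _ _ (partial t k n V Y) /\
  (\int[P]_w (`|partial t k n V Y w| ^+ 2)%:E
    <= (n%:R * (t ^+ 2 * c))%:E + \int[P]_w (`|Y w| ^+ 2)%:E)%E.
Proof.
move=> nm aV aY; elim: n nm => [|n IH] nm.
  have partial0 : partial t k 0 V Y = Y.
    by apply/funext => w; rewrite /partial big_pred0 ?add0r.
  by rewrite partial0 mul0r add0e.
have [aP IHn] := IH (ltnW nm).
pose j : I := Tagged (fun k => 'I_(m k)) (Ordinal nm).
have jS : ~ past k n j by case=> /=; [rewrite ltnn | case=> _; rewrite ltnn].
have jS' : past k n.+1 j by right.
have sub n' : past k 0 `<=` past k n'.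
  by move=> i [ik|[_]//]; left.
have subS : past k n `<=` past k n.+1.
  by move=> i [ik|[ik ni]]; [left | right; split=> //; exact: ltnW].
have partialE : partial t k n.+1 V Y = fun w =>
    t *: (G (V w) (sample' j w) - g (V w)) + partial t k n V Y w.
  by apply/funext => w; rewrite partialS.
rewrite partialE; split.
  apply: approximableD; last exact: approximable_info_incl subS aP.
  apply: approximableZ.
  apply: (@approximable_err R U d d' Omega T' P I sample' Xi _ G g _ _ _ (past
      k n.+1) j) => //.
    by move=> i w; exact: sample_Xi.
  exact: approximable_info_incl (sub n.+1) aV.
have aVn := approximable_info_incl (sub n) aV.
have := @one_step R U dot dot_norm d d' Omega T' P I sample' xi Xi xi_Xi
  (fun i w => sample_Xi (tagged i) w)
      (fun i => sample_distr (tagged i)) sample_indep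
  G g c c_ge0 G_measurable G_continuous g_continuous G_unbiased G_variance
  (past k n) j V (partial t k n V Y) t jS aVn aP.
move=> h; apply: (le_trans h); apply: (le_trans (leeD2l _ IHn)).
by rewrite addeA -EFinD -natr1 mulrDl mul1r [t ^+ 2 * c + _]addrC.
Qed.

(** Taking [t = phi / m k] for every sample gives [m k * t^2 * c = phi^2 c / m k], the variance
    reduction of the batch. *)
Lemma batch_moment (k : nat) (phi : R) (V Y : Omega -> U) : (0 < m k)%N ->
  adapted k V -> adapted k Y ->
  adapted k.+1 (batch_error k V) /\
  (\int[P]_w (`|phi *: batch_error k V w + Y w| ^+ 2)%:E
    <= (phi ^+ 2 * c / (m k)%:R)%:E + \int[P]_w (`|Y w| ^+ 2)%:E)%E.
Proof.
move=> mk aV aY.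
have mk0 : (m k)%:R != 0 :> R by rewrite pnatr_eq0 -lt0n.
have errE t w : partial (t / (m k)%:R) k (m k) V Y w = t *: batch_error k V w
    + Y w.
  rewrite /partial; congr (_ + _).
  under eq_bigl => i do rewrite ltn_ord.
  rewrite -scaler_sumr -scalerA; congr (_ *: _).
  by rewrite big_split/= sumrN sumr_const card_ord scalerBr -[g _ *+
      _]scaler_nat scalerA mulVf ?scale1r.
split.
  have [+ _] := partial_moment (1 / (m k)%:R) (leqnn _) aV aY.
  have -> : batch_error k V = fun w =>
      partial (1 / (m k)%:R) k (m k) V Y w - Y w.
    by apply/funext => w; rewrite errE scale1r addrK.
  move=> /adaptedS aP; apply: approximableB => //.
  by apply: adaptedS aY.
have [_] := partial_moment (phi / (m k)%:R) (leqnn _) aV aY.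
under eq_integral do rewrite errE.
have -> // : (m k)%:R * ((phi / (m k)%:R) ^+ 2 * c) = phi ^+ 2 * c / (m k)%:R.
by field.
Qed.

End batch.

Section square_integrable.
Context {R : realType} {U : normedModType R} {d : measure_display}
  {Omega : measurableType d} (P : probability Omega R).

Definition square_integrable (X : Omega -> U) : Prop :=
  countably_approximable X /\ (\int[P]_w (`|X w| ^+ 2)%:E < +oo)%E.

Lemma measurable_norm2 (X : Omega -> U) : countably_approximable X ->
  measurable_fun setT (fun w => (`|X w| ^+ 2)%:E).
Proof.
move=> aX; apply/measurable_EFinP; apply: measurable_funX.
exact: approximable_measurable_norm.
Qed.

Lemma square_integrable_dominated (X Y Z : Omega -> U) (a b : R) :
  0 <= a -> 0 <= b ->
  square_integrable X -> square_integrable Y -> countably_approximable Z ->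
  (forall w, `|Z w| <= a + b * (`|X w| + `|Y w|)) -> square_integrable Z.
Proof.
move=> a0 b0 [aX X2] [aY Y2] aZ ZXY; split=> //.
have mX := measurable_norm2 aX; have mY := measurable_norm2 aY.
pose B w := ((3 * a ^+ 2)%:E + (3 * b ^+ 2)%:E * ((`|X w| ^+ 2)%:E + (`|Y w|
    ^+ 2)%:E))%E.
apply: (@le_lt_trans _ _ (\int[P]_w B w)%E).
  apply: ge0_le_integral => //.
  - exact: measurable_norm2.
  - apply: emeasurable_funD => //; apply: measurable_funeM;
      exact: emeasurable_funD.
  - move=> w _; rewrite /B -!(EFinD, EFinM) lee_fin.
    have := ZXY w; have := normr_ge0 (Z w).
    set z := `|Z w|; set x := b * `|X w|; set y := b * `|Y w|.
    have -> : 3 * b ^+ 2 * (`|X w| ^+ 2 + `|Y w| ^+ 2) = 3 * (x ^+ 2 + y ^+ 2).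
      by rewrite /x /y; ring.
    rewrite mulrDr -/x -/y => z0 zle.
    have : z ^+ 2 <= (a + (x + y)) ^+ 2 by rewrite ler_sqr ?nnegrE//; lra.
    have := sqr_ge0 (x - y); have := sqr_ge0 (x - a); have := sqr_ge0 (y - a).
    nra.
have nn (Q : Omega -> U) w : (0 <= (`|Q w| ^+ 2)%:E)%E by rewrite lee_fin
    sqr_ge0.
rewrite /B ge0_integralD//; last 3 first.
- by move=> w _; rewrite lee_fin mulr_ge0 ?sqr_ge0.
- by move=> w _; rewrite mule_ge0 ?adde_ge0// lee_fin mulr_ge0 ?sqr_ge0.
- by apply: measurable_funeM; exact: emeasurable_funD.
rewrite ge0_integralZl//; last 3 first.
- exact: emeasurable_funD.
- by move=> w _; rewrite adde_ge0.
- by rewrite lee_fin mulr_ge0 ?sqr_ge0.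
rewrite ge0_integralD// lte_add_pinfty//.
  rewrite integral_cst//; apply: (@le_lt_trans _ _ ((3 * a ^+ 2)%:E * 1)%E).
    by apply: lee_wpmul2l; [rewrite lee_fin mulr_ge0 ?sqr_ge0 | exact:
        probability_le1].
  by rewrite mule1 ltry.
by apply: lte_mul_pinfty => //;
  [rewrite lee_fin mulr_ge0 ?sqr_ge0 | exact: lte_add_pinfty].
Qed.

Lemma square_integrable_cst (x : U) : square_integrable (fun=> x).
Proof.
split; first exact: approximable_cst.
rewrite integral_cst//; apply: (@le_lt_trans _ _ ((`|x| ^+ 2)%:E * 1)%E).
  by apply: lee_wpmul2l; [rewrite lee_fin sqr_ge0 | exact: probability_le1].
by rewrite mule1 ltry.
Qed.

(** A Lipschitz function grows at most linearly; the additive constant is read off at the arbitrary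
    outcome [point]. *)
Lemma square_integrable_lipschitz (C : R) (X Z : Omega -> U) : 0 <= C ->
  square_integrable X -> (forall w w', `|Z w - Z w'| <= C * `|X w - X w'|) ->
  square_integrable Z.
Proof.
move=> C0 X2 ZX.
apply: (@square_integrable_dominated X X Z (`|Z point| + C * `|X point|) C) =>
    //.
- by rewrite addr_ge0// mulr_ge0.
- by case: X2 => aX _; exact: approximable_lipschitz aX ZX.
move=> w; have h1 := ler_normD (Z w - Z point) (Z point).
rewrite subrK in h1; have h2 := ler_normB (X w) (X point).
have : C * `|X w - X point| <= C * (`|X w| + `|X point|) by rewrite ler_wpM2l.
have : 0 <= C * `|X w| by rewrite mulr_ge0.
by have := ZX w point; lra.
Qed.

Lemma square_integrableD (X Y : Omega -> U) :
  square_integrable X -> square_integrable Y ->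
  square_integrable (fun w => X w + Y w).
Proof.
move=> X2 Y2; apply: (@square_integrable_dominated X Y _ 0 1) => //.
  by case: X2 => ? _; case: Y2 => ? _; exact: approximableD.
by move=> w; rewrite add0r mul1r ler_normD.
Qed.

Lemma square_integrableZ (a : R) (X : Omega -> U) :
  square_integrable X -> square_integrable (fun w => a *: X w).
Proof.
move=> X2; apply: (@square_integrable_lipschitz `|a| X) => // w w'.
by rewrite -scalerBr normrZ.
Qed.

Lemma square_integrableB (X Y : Omega -> U) :
  square_integrable X -> square_integrable Y ->
  square_integrable (fun w => X w - Y w).
Proof.
move=> X2 /(square_integrableZ (-1)) Y2.
have -> : (fun w => X w - Y w) = fun w => X w + -1 *: Y w.
  by apply/funext => w; rewrite scaleN1r.
exact: square_integrableD.
Qed.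

Lemma square_integrable_integrable (X : Omega -> U) :
  square_integrable X -> P.-integrable setT (fun w => (`|X w| ^+ 2)%:E).
Proof.
move=> [aX X2]; apply/integrableP; split; first exact: measurable_norm2.
by under eq_integral do rewrite abse_EFin ger0_norm ?sqr_ge0//.
Qed.

End square_integrable.

(** * The stochastic ADMM iterates *)

Lemma coercive_norm_le {R : realType} {U : normedModType R}
    (dot : {dot U for idfun}) (dot_norm : forall x : U, dot x x = `|x| ^+ 2)
    (a : R) (x y : U) :
  0 < a -> a * `|x| ^+ 2 <= dot y x -> `|x| <= a^-1 * `|y|.
Proof.
move=> a0 h; have [->|x0] := eqVneq x 0;
    first by rewrite normr0 mulr_ge0// invr_ge0 ltW.
have nx : 0 < `|x| by rewrite normr_gt0.
rewrite ler_pdivlMl// -(ler_pM2r nx); apply: le_trans (dot_le dot_norm _ _).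
by apply: le_trans h; rewrite expr2 mulrA.
Qed.

Section stochastic_admm_analysis.
Context {R : realType} {U : normedModType R} (dot : {dot U for idfun}).
Hypothesis dot_norm : forall x : U, dot x x = `|x| ^+ 2.
Context (Uad : set U).
Hypothesis Uad_convex : convex_set (Uad : set (convex_lmodType U)).
Context {d d' : measure_display} {Omega : measurableType d}
  {T' : measurableType d'} (P : probability Omega R).
Context (Xi : set T') (xi : {RV P >-> T'}).
Hypothesis xi_Xi : forall w, Xi (xi w).
Context (F : U -> T' -> R) (gradF : U -> T' -> U).
Hypothesis F_convex : forall y, Xi y ->
  convex_function (setT : set (convex_lmodType U)) (F ^~ y).
Hypothesis F_grad : forall y, Xi y ->
  forall x, is_gradient dot (F ^~ y) x (gradF x y).
Context (f : U -> R) (gradf : U -> U).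
Hypothesis f_grad : forall x, is_gradient dot f x (gradf x).
Context (g : U -> \bar R).
Hypotheses (g_proper : eproper g) (g_lsc : lower_semicontinuous g)
  (g_convex : econvex g).
Context (L : R).
Hypothesis f_convex : forall x y, f x + dot (gradf x) (y - x) <= f y.
Hypothesis f_smooth : forall x y, `|gradf x - gradf y| <= L * `|x - y|.
Context (varrho : R).
Hypothesis gradF_measurable : forall x, strongly_measurable Xi (gradF x).
Hypothesis gradF_unbiased : forall x,
  has_bochner_expectation P (fun w => gradF x (xi w)) (gradf x).
Hypothesis gradF_variance : forall x,
  (\int[P]_w (`|gradF x (xi w) - gradf x| ^+ 2)%:E <= (varrho ^+ 2)%:E)%E.
Context (us lambdas : U).
Hypothesis us_ad : Uad us.
Hypothesis lambdas_optimal : forall x y, Uad x ->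
  (0 <= g y - g us + (dot (gradf us) (x - us) - dot lambdas (x - y))%R%:E)%E.
Context (mu rho eta : R) (m : nat -> nat) (M : R).
Hypotheses (mu01 : 0 < mu < 1) (rho_gt0 : 0 < rho) (eta_gt0 : 0 < eta).
Hypothesis eta_large : mu * rho / (1 - mu) + L < eta.
Hypothesis m_gt1 : forall k, (1 < m k)%N.
Hypothesis m_sum : series (fun k => (m k)%:R^-1 : R) @ \oo --> M^-1.
Context (sample : forall k, 'I_(m k) -> {RV P >-> T'}).
Hypothesis sample_Xi : forall k (i : 'I_(m k)) w, Xi (sample i w).
Hypothesis sample_distr : forall k (i : 'I_(m k)),
  identically_distributed (sample i) xi.
Hypothesis sample_indep : mutually_independent
  (fun j : {k : nat & 'I_(m k)} => sample (tagged j)).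
Context (u0 z0 lambda0 : U) (u z v s psi lambda : nat -> Omega -> U).
Hypothesis admm : stochastic_admm dot Uad g gradF mu
  (fun=> rho) (fun=> eta) (fun k => k.+1%:R) (fun k i => @sample k i)
  u0 z0 lambda0 u z v s psi lambda.

(** * Constants, running averages and the multiplier recursion *)

Let phi : R := (1 - mu) / (eta * (1 - mu) - mu * rho - L * (1 - mu)).

Let mu_lt1 : 0 < 1 - mu. Proof. by case/andP: mu01; lra. Qed.
Let mu_gt0 : 0 < mu. Proof. by case/andP: mu01. Qed.

Let den_gt0 : 0 < eta * (1 - mu) - mu * rho - L * (1 - mu).
Proof.
have : (mu * rho / (1 - mu) + L) * (1 - mu) < eta * (1 - mu) by rewrite
    ltr_pM2r.
by rewrite mulrDl divfK ?gt_eqF//; lra.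
Qed.

Let phi_gt0 : 0 < phi. Proof. by rewrite divr_gt0. Qed.

Let phiE : phi^-1 = eta - mu * rho / (1 - mu) - L.
Proof. by rewrite /phi; field; rewrite !gt_eqF. Qed.

(** With [theta_k = k + 1] the products [K x_K] are running sums. At [K = 0] the initial value has
    weight 0 and disappears. *)
Let weighted_mean (x y : nat -> Omega -> U) K w :
  (forall k w, x k.+1 w =
    (1 - k.+1%:R^-1) *: x k w + k.+1%:R^-1 *: y k.+1 w) ->
  K.+1%:R *: x K.+1 w = K%:R *: x K w + y K.+1 w.
Proof.
move=> ->; have K0 : K.+1%:R != 0 :> R by rewrite pnatr_eq0.
rewrite scalerDr !scalerA mulfV// scale1r mulrBr mulr1 mulfV//.
by rewrite -natr1 addrK.
Qed.

Let u_mean K w : K.+1%:R *: u K.+1 w = K%:R *: u K w + v K.+1 w.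
Proof. by apply: weighted_mean; exact: (admm_u admm). Qed.

Let z_mean K w : K.+1%:R *: z K.+1 w = K%:R *: z K w + s K.+1 w.
Proof. by apply: weighted_mean; exact: (admm_z admm). Qed.

Let psiE k w : psi k w = lambda k w + (mu * rho * k%:R) *: (u k w - z k w).
Proof.
case: k => [|k]; last by rewrite (admm_lambda admm) subrK.
by rewrite (admm_psi0 admm) (admm_lambda0 admm) mulr0 scale0r addr0.
Qed.

(** By [psiE], [lambda] differs from [psi] by [mu rho] times the running sum of the residuals. A new
    residual enters once through [psi] and once through that sum, hence the factor 2. *)
Let lambdaS k w :
  lambda k.+1 w = lambda k w - (2 * mu * rho) *: (v k.+1 w - s k.+1 w).
Proof.
rewrite (admm_lambda admm) (admm_psi admm) psiE /=.
rewrite -[(mu * rho * k%:R) *: _]scalerA -[(mu * rho * k.+1%:R) *: _]scalerA.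
have -> : k.+1%:R *: (u k.+1 w - z k.+1 w) =
    k%:R *: (u k w - z k w) + (v k.+1 w - s k.+1 w).
  by rewrite !scalerBr u_mean z_mean opprD addrACA.
have -> : (2 * mu * rho) *: (v k.+1 w - s k.+1 w) =
    (mu * rho) *: (v k.+1 w - s k.+1 w) + (mu * rho) *: (v k.+1 w - s k.+1 w).
  by rewrite -scalerDl; congr (_ *: _); ring.
move: (v k.+1 w - s k.+1 w) (k%:R *: (u k w - z k w)) => r x.
by rewrite scalerDr !opprD !addrA (addrAC _ ((mu * rho) *: x)) addrK.
Qed.

(** * Measurability and square integrability of the iterates *)

Let batch k w : U :=
  (m k)%:R^-1 *: \sum_(i < m k) gradF (v k w) (sample i w).

Let s_prox k w : g (s k.+1 w) \is a fin_num /\ forall y,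
  (g (s k.+1 w) + (dot (lambda k w + rho *: (s k.+1 w - v k w))
                       (s k.+1 w - y))%:E <= g y)%E.
Proof. by apply: (argmin_prox dot_norm g_proper g_convex);
    exact: (admm_s admm). Qed.

Let v_projection k w : Uad (v k.+1 w) /\ forall y, Uad y ->
  dot (batch k w - lambda k w + rho *: (v k.+1 w - s k.+1 w)
       + eta *: (v k.+1 w - v k w)) (v k.+1 w - y) <= 0.
Proof.
apply: (argmin_projection dot_norm); last exact: (admm_v admm).
by move=> a b t Aa Ab t01; exact: (convex_set_segment (A := Uad)).
Qed.

Let X1 k w := rho *: v k w - lambda k w.
Let X2 k w := rho *: s k.+1 w + eta *: v k w - (batch k w - lambda k w).

(** The optimality conditions at [w] and [w'], each tested at the other minimizer, are added; the
    values of [g] cancel and [rho |x - x'|^2 <= <X1 - X1', x - x'>] remains. *)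
Let s_lipschitz k w w' : `|s k.+1 w - s k.+1 w'| <= rho^-1 * `|X1 k w - X1 k
    w'|.
Proof.
apply: (coercive_norm_le dot_norm) => //.
have [gs hs] := s_prox k w; have [gs' hs'] := s_prox k w'.
move: (hs (s k.+1 w')) (hs' (s k.+1 w));
    rewrite -(fineK gs) -(fineK gs') -!EFinD !lee_fin.
set x := s k.+1 w; set x' := s k.+1 w' => h1 h2.
move: h1 h2; rewrite -dot_norm /X1 !dotE (dotC dot x' x); lra.
Qed.

Let v_lipschitz k w w' :
  `|v k.+1 w - v k.+1 w'| <= (rho + eta)^-1 * `|X2 k w - X2 k w'|.
Proof.
apply: (coercive_norm_le dot_norm); first exact: addr_gt0.
have [vw hv] := v_projection k w; have [vw' hv'] := v_projection k w'.
move: (hv _ vw') (hv' _ vw).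
set x := v k.+1 w; set x' := v k.+1 w' => h1 h2.
move: h1 h2; rewrite -dot_norm /X2 !dotE (dotC dot x' x); lra.
Qed.

Let gradF_continuous y : Xi y -> continuous (gradF ^~ y).
Proof.
move=> Xy; apply: (convex_gradient_continuous dot_norm (F_convex Xy)) => x.
exact: F_grad.
Qed.

Let gradf_lipschitz x y : `|gradf x - gradf y| <= `|L| * `|x - y|.
Proof. by apply: le_trans (f_smooth x y) _; rewrite ler_wpM2r// ler_norm. Qed.

Let gradf_continuous : continuous gradf.
Proof.
move=> x; apply/cvgrPdist_le => e e0.
have L1 : 0 < `|L| + 1 by have := normr_ge0 L; lra.
near=> y; apply: le_trans (gradf_lipschitz _ _) _.
have : `|x - y| < e / (`|L| + 1).
  near: y; apply/nbhs_ballP; exists (e / (`|L| + 1)) => /=;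
      first by rewrite divr_gt0.
  by move=> y; rewrite -ball_normE.
rewrite ltr_pdivlMr//; have := normr_ge0 (x - y); have := normr_ge0 L; nra.
Unshelve. all: by end_near.
Qed.

Let f_continuous : continuous f.
Proof. by move=> x; apply: differentiable_continuous; have [] := f_grad x. Qed.

Let error := batch_error sample gradF gradf.
Let known k (V : Omega -> U) : Prop := adapted sample k V.

Let error_moment k (V Y : Omega -> U) : known k V -> known k Y ->
  known k.+1 (error k V) /\
  (\int[P]_w (`|phi *: error k V w + Y w| ^+ 2)%:E
    <= (phi ^+ 2 * varrho ^+ 2 / (m k)%:R)%:E + \int[P]_w (`|Y w| ^+ 2)%:E)%E.
Proof.
move=> aV aY; apply: (batch_moment dot_norm xi_Xi sample_Xi sample_distr
  sample_indep (sqr_ge0 varrho) gradF_measurable gradF_continuous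
  gradf_continuous gradF_unbiased gradF_variance) => //.
exact: ltn_trans (m_gt1 k).
Qed.

Let square_integrable_error k (V : Omega -> U) :
  known k V -> square_integrable P V ->
  square_integrable P (error k V).
Proof.
move=> aV V2; have [ae e2] := error_moment aV aV.
have ae' := adapted_approximable ae.
have : square_integrable P (fun w => phi *: error k V w + V w).
  split; first by apply: approximableD; [exact: approximableZ | case: V2].
  apply: le_lt_trans e2 _; rewrite lte_add_pinfty ?ltry//.
  by case: V2.
move=> /(square_integrableB) /(_ V2) /(square_integrableZ phi^-1).
congr square_integrable; apply/funext => w.
by rewrite addrK scalerA mulVf ?gt_eqF// scale1r.
Qed.

Let batchE k w : batch k w = error k (v k) w + gradf (v k w).
Proof. by rewrite /error /batch_error subrK. Qed.

(** The map [h] lets the same statement serve on [Omega] and, with the identity, on the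
    sigma-algebras [info]. *)
Let approximable_s k (d0 : measure_display) (T : measurableType d0)
    (h : T -> Omega) :
  countably_approximable (fun w => v k (h w)) ->
  countably_approximable (fun w => lambda k (h w)) ->
  countably_approximable (fun w => s k.+1 (h w)).
Proof.
move=> av al; apply: (approximable_lipschitz (C := rho^-1)
    (X := fun w => X1 k (h w))).
  by apply: approximableB => //; exact: approximableZ.
by move=> w w'; exact: s_lipschitz.
Qed.

Let approximable_v k (d0 : measure_display) (T : measurableType d0)
    (h : T -> Omega) :
  countably_approximable (fun w => v k (h w)) ->
  countably_approximable (fun w => lambda k (h w)) ->
  countably_approximable (fun w => error k (v k) (h w)) ->
  countably_approximable (fun w => v k.+1 (h w)).
Proof.
move=> av al ae; apply: (approximable_lipschitz (C := (rho + eta)^-1)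
    (X := fun w => X2 k (h w))).
  apply: approximableB; first apply: approximableD.
  - by apply: approximableZ; exact: approximable_s.
  - exact: approximableZ.
  apply: approximableB => //.
  have -> : (fun w => batch k (h w)) = fun w => error k (v k)
      (h w) + gradf (v k (h w)).
    by apply/funext => w; rewrite batchE.
  apply: approximableD => //.
  by apply: (approximable_lipschitz (C := L) (X := fun w => v k (h w))).
by move=> w w'; exact: v_lipschitz.
Qed.

(** [v] and [lambda] suffice as state, since [s k.+1] is recovered from them. Finite second moments
    are carried along because the noise is a difference of two squares whose integrals must be
    finite. *)
Let state_invariant k : [/\ known k (v k), known k (lambda k),
  square_integrable P (v k) & square_integrable P (lambda k)].
Proof.
elim: k => [|k [av al v2 l2]].
  have -> : v 0%N = fun=> u0 by apply/funext => w; exact: (admm_v0 admm).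
  have -> : lambda 0%N = fun=> lambda0 by apply/funext => w;
      exact: (admm_lambda0 admm).
  split; [exact: approximable_cst | exact: approximable_cst |
    exact: square_integrable_cst | exact: square_integrable_cst].
have [ae _] := error_moment av al; have e2 := square_integrable_error av v2.
have av' := adaptedS av; have al' := adaptedS al.
have as' : known k.+1 (s k.+1) by apply: (@approximable_s k _ (info _ _) id);
    [exact: av' | exact: al'].
have av1 : known k.+1 (v k.+1) by apply: (@approximable_v k _ (info _ _) id);
    [exact: av' | exact: al' | exact: ae].
have s2 : square_integrable P (s k.+1).
  apply: (square_integrable_lipschitz (C := rho^-1) (X := X1 k)).
  - by rewrite invr_ge0 ltW.
  - by apply: square_integrableB => //; exact: square_integrableZ.
  - exact: s_lipschitz.
have v2' : square_integrable P (v k.+1).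
  apply: (square_integrable_lipschitz (C := (rho + eta)^-1) (X := X2 k)).
  - by rewrite invr_ge0 addr_ge0 ?ltW.
  - apply: square_integrableB; first by apply: square_integrableD;
      exact: square_integrableZ.
    apply: square_integrableB => //.
    have -> : batch k = fun w => error k (v k) w + gradf (v k w).
      by apply/funext => w; rewrite batchE.
    apply: square_integrableD => //.
    by apply: (square_integrable_lipschitz (C := `|L|) (X := v k)).
  - exact: v_lipschitz.
have lE : lambda k.+1 = fun w => lambda k w - (2 * mu * rho) *: (v k.+1 w - s
    k.+1 w).
  by apply/funext => w; exact: lambdaS.
rewrite lE; split=> //.
  by apply: approximableB => //; apply: approximableZ; exact: approximableB.
by apply: square_integrableB => //; apply: square_integrableZ;
    exact: square_integrableB.
Qed.

(** * Expectation of the noise *)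

Let noise k w := admm_noise phi (error k (v k) w) (v k w - us).

Let noise_integral k : P.-integrable setT (fun w => (noise k w)%:E) /\
  (\int[P]_w (noise k w)%:E <= (phi * varrho ^+ 2 / 2 * (m k)%:R^-1)%:E)%E.
Proof.
have [av al v2 l2] := state_invariant k.
pose Y w := - (v k w - us).
have aY : known k Y.
  by apply: approximableN; apply: approximableB => //; exact: approximable_cst.
have Y2 : square_integrable P Y.
  have -> : Y = fun w => us - v k w by apply/funext => w; rewrite /Y opprB.
  by apply: square_integrableB => //; exact: square_integrable_cst.
have [_ eY] := error_moment av aY.
have e2 := square_integrable_error av v2.
pose Z w := phi *: error k (v k) w + Y w.
have Z2 : square_integrable P Z by apply: square_integrableD => //;
    exact: square_integrableZ.
have iY := square_integrable_integrable Y2.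
have iZ := square_integrable_integrable Z2.
have noiseE : (fun w => (noise k w)%:E) = (fun w => ((2 * phi)^-1)%:E *
    ((`|Z w| ^+ 2)%:E - (`|Y w| ^+ 2)%:E))%E.
  by apply/funext => w; rewrite -EFinB -EFinM /noise /admm_noise /Z /Y normrN.
have iZY := integrableB measurableT iZ iY.
rewrite noiseE; split; first exact: integrableZl.
rewrite integralZl// integralB//.
have finY := integrable_fin_num measurableT iY.
have finZ := integrable_fin_num measurableT iZ.
have {}eY : (\int[P]_w (`|Z w| ^+ 2)%:E <= (phi ^+ 2 * varrho ^+ 2 / (m
    k)%:R)%:E
    + \int[P]_w (`|Y w| ^+ 2)%:E)%E by [].
move: eY; rewrite -(fineK finY) -(fineK finZ) -EFinD -EFinB -EFinM !lee_fin.
set a := fine _; set b := fine _ => ab.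
have -> : phi * varrho ^+ 2 / 2 * (m k)%:R^-1 =
    (2 * phi)^-1 * (phi ^+ 2 * varrho ^+ 2 / (m k)%:R).
  have mk0 : (m k)%:R != 0 :> R by rewrite pnatr_eq0 -lt0n ltnW.
  by field; rewrite mk0 gt_eqF.
have c0 : 0 < (2 * phi)^-1 by rewrite invr_gt0 mulr_gt0.
by rewrite ler_pM2l//; lra.
Qed.

Let noise_sum_integral K : P.-integrable setT
    (fun w => (\sum_(k < K) noise k w)%:E) /\
  (\int[P]_w (\sum_(k < K) noise k w)%:E <= (phi * varrho ^+ 2 / (2 * M))%:E)%E.
Proof.
have E : (fun w => (\sum_(k < K) noise k w)%:E) = (fun w => \sum_(k < K)
    (noise k w)%:E)%E.
  by apply/funext => w; rewrite sumEFin.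
rewrite E; split.
  by apply: integrable_sum => // k _; have [] := noise_integral k.
rewrite integral_sum//; last by move=> k; have [] := noise_integral k.
apply: (@le_trans _ _ (\sum_(k < K)
    (phi * varrho ^+ 2 / 2 * (m k)%:R^-1)%:E)%E).
  by apply: lee_sum => k _; have [] := noise_integral k.
rewrite sumEFin lee_fin -mulr_sumr.
have sumM : \sum_(k < K) (m k)%:R^-1 <= M^-1 :> R.
  have : series (fun k => (m k)%:R^-1 : R) K <= M^-1.
    rewrite -(cvg_lim _ m_sum)//; apply: nondecreasing_cvgn_le.
      by apply: nondecreasing_series => k _ _; rewrite invr_ge0.
    by apply/cvg_ex; exists M^-1.
  by rewrite /series/= big_mkord.
have -> : phi * varrho ^+ 2 / (2 * M) = phi * varrho ^+ 2 / 2 * M^-1.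
  by rewrite invfM mulrA.
apply: ler_wpM2l => //.
by rewrite divr_ge0// mulr_ge0 ?sqr_ge0// ltW.
Qed.

(** * Pathwise estimates *)

Let g_us : g us \is a fin_num.
Proof.
have [gNy [y gy]] := g_proper; rewrite fin_numE gNy/=; apply/eqP => gus.
(* If [g us] were [+oo], testing at a point [y] of finite value would make the multiplier expression
   [-oo]. *)
have := lambdas_optimal y us_ad; rewrite gus.
by case: (g y) (gNy y) gy.
Qed.

Let u_ad K w : Uad (u K.+1 w).
Proof.
elim: K => [|K IH].
  (* [u_1 = v_1] whatever [u_0] is, so feasibility starts at index 1. *)
  have := u_mean 0 w; rewrite scale1r scale0r add0r => ->.
  by have [] := v_projection 0 w.
rewrite (admm_u admm) addrC; apply: (convex_set_segment Uad_convex) IH _.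
  by have [] := v_projection K.+1 w.
by rewrite invr_gt0 ltr0n invf_le1 ?ltr0n ?ler1n.
Qed.

(** Jensen from tangents at [u K.+1]: in the weighted sum the gradient terms cancel by [u_mean]. *)
Let f_mean K w : K.+1%:R * f (u K.+1 w) <= K%:R * f (u K w) + f (v K.+1 w).
Proof.
have h1 := f_convex (u K.+1 w) (u K w).
have h2 := f_convex (u K.+1 w) (v K.+1 w).
have h1' := ler_wpM2l (ler0n R K) h1.
have : dot (gradf (u K.+1 w)) (K%:R *: u K w + v K.+1 w - K.+1%:R *: u K.+1 w)
    = 0.
  by rewrite u_mean subrr dot0r.
move: h1' h2; rewrite -natr1 !dotE; lra.
Qed.

Let g_mean K w : g (z K.+1 w) \is a fin_num /\
  K.+1%:R * fine (g (z K.+1 w)) <= K%:R * fine (g (z K w)) + fine (g (s K.+1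
      w)).
Proof.
elim: K => [|K [gz IH]].
  (* [g (z 0 w)] may be infinite, but its [fine] value is multiplied by 0. *)
  have := z_mean 0 w; rewrite scale1r scale0r add0r => ->.
  by have [gs _] := s_prox 0 w; split=> //; rewrite mul1r mul0r add0r.
have [gs _] := s_prox K.+1 w.
pose t : R := K.+2%:R^-1.
have K2 : 0 < K.+2%:R :> R by rewrite ltr0n.
have t01 : 0 <= t <= 1 by rewrite /t invr_ge0 ltW//= invf_le1// ler1n.
have := g_convex (s K.+2 w) (z K.+1 w) t01.
have -> : t *: s K.+2 w + (1 - t) *: z K.+1 w = z K.+2 w.
  by rewrite (admm_z admm K.+1 w) addrC.
rewrite -(fineK gz) -(fineK gs) -!EFinM -EFinD => gle.
have gfin : g (z K.+2 w) \is a fin_num.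
  rewrite fin_numE (g_proper.1 _)/= -ltey; apply: le_lt_trans gle _.
  by rewrite ltry.
split=> //; move: gle; rewrite -(fineK gfin) lee_fin => gle.
rewrite /=; apply: le_trans (ler_wpM2l (ltW K2) gle) _.
rewrite le_eqVlt; apply/orP; left; apply/eqP; move: K2.
by rewrite /t -[K.+2%:R]natr1 => K2; field; rewrite gt_eqF.
Qed.

Let gap K w := f (u K w) + fine (g (z K w)) - f us - fine (g us).

Let path_bound K w (l : U) :
  K%:R * gap K w - dot l (K%:R *: (u K w - z K w)) <=
    (rho + eta) / 2 * (`|u0 - us| ^+ 2 - `|v K w - us| ^+ 2)
    + (4 * mu * rho)^-1 * (`|lambda0 - l| ^+ 2 - `|lambda K w - l| ^+ 2)
    + \sum_(k < K) noise k w.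
Proof.
elim: K => [|K IH].
  rewrite mul0r scale0r dot0r subrr big_ord0 (admm_v0 admm) (admm_lambda0 admm).
  by rewrite !subrr !mulr0 !addr0.
have [gs hs] := s_prox K w; have [vA hv] := v_projection K w.
have {}hs : fine (g (s K.+1 w)) + dot (lambda K w + rho *: (s K.+1 w - v K w))
    (s K.+1 w - us) <= fine (g us).
  by have := hs us; rewrite -(fineK gs) -(fineK g_us) -EFinD lee_fin.
have := admm_step_le dot_norm mu01 rho_gt0 phi_gt0 phiE hs (hv us us_ad)
  (descent dot_norm f_convex f_smooth (v K w) (v K.+1 w))
      (f_convex (v K w) us) l.
rewrite -lambdaS -[admm_noise _ _ _]/(noise K w) => step.
rewrite big_ord_recr /=.
have -> : K.+1%:R *: (u K.+1 w - z K.+1 w) =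
    K%:R *: (u K w - z K w) + (v K.+1 w - s K.+1 w).
  by rewrite !scalerBr u_mean z_mean opprD addrACA.
rewrite dotDr.
have [_ gm] := g_mean K w; have fm := f_mean K w.
move: IH step gm fm; rewrite /gap -natr1; lra.
Qed.

Let approximable_iterates K : countably_approximable (u K) /\
    countably_approximable (z K).
Proof.
elim: K => [|K [au az]].
  have -> : u 0%N = fun=> u0 by apply/funext => w; exact: (admm_u0 admm).
  have -> : z 0%N = fun=> z0 by apply/funext => w; exact: (admm_z0 admm).
  by split; exact: approximable_cst.
have -> : u K.+1 = fun w => (1 - K.+1%:R^-1) *: u K w + K.+1%:R^-1 *: v K.+1 w.
  by apply/funext => w; exact: (admm_u admm).
have -> : z K.+1 = fun w => (1 - K.+1%:R^-1) *: z K w + K.+1%:R^-1 *: s K.+1 w.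
  by apply/funext => w; exact: (admm_z admm).
have [_ _ [av _] [al _]] := state_invariant K.
have [_ _ [av' _] _] := state_invariant K.+1.
split; apply: approximableD; apply: approximableZ => //.
exact: (approximable_s (h := id) av al).
Qed.

(** * From pathwise bounds to expectations *)

Section conclusion.
Variables (c : R) (K : nat).
Hypotheses (c_gt0 : 0 < c) (c_ge : 2 * `|lambdas| <= c).

Let C1 : R := (eta + rho) / 2 * `|u0 - us| ^+ 2
  + (c ^+ 2 + `|lambda0| ^+ 2) / (mu * rho).

Let gap_penalty w : K.+1%:R * (gap K.+1 w + c * `|u K.+1 w - z K.+1 w|) <=
  C1 + \sum_(k < K.+1) noise k w.
Proof.
set x := u K.+1 w - z K.+1 w.
(* At [x = 0] the convention [0^-1 = 0] gives [l = 0], which satisfies both facts needed. *)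
pose l := - ((c / `|x|) *: x).
have lx : dot l x = - (c * `|x|).
  rewrite /l dotNl dotZl dot_norm; have [->|x0] := eqVneq x 0.
    by rewrite normr0 invr0 expr2 !mulr0.
  by rewrite expr2 mulrA divfK// normr_eq0.
have ll : `|l| <= c.
  rewrite normrN normrZ normrM normfV normr_id gtr0_norm//.
  have [->|x0] := eqVneq x 0; first by rewrite normr0 mulr0 ltW.
  by rewrite divfK// normr_eq0.
have := path_bound K.+1 w l; rewrite -/x dotZr lx.
have pos1 : 0 <= (rho + eta) / 2 * `|v K.+1 w - us| ^+ 2.
  by rewrite mulr_ge0 ?sqr_ge0// divr_ge0// addr_ge0 ?ltW.
have mr0 : 0 < mu * rho by rewrite mulr_gt0.
have pos2 : 0 <= (4 * mu * rho)^-1 * `|lambda K.+1 w - l| ^+ 2.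
  by rewrite mulr_ge0 ?sqr_ge0// invr_ge0 -mulrA mulr_ge0// ltW.
(* [|lambda0 - l|^2 <= (|lambda0| + c)^2 <= 2 (c^2 + |lambda0|^2)]; the claimed constant has another
   factor 2 to spare. *)
have : (4 * mu * rho)^-1 * `|lambda0 - l| ^+ 2 <= (c ^+ 2 + `|lambda0| ^+ 2) /
    (mu * rho).
  have -> : (4 * mu * rho)^-1 = 4^-1 / (mu * rho) by rewrite -mulrA invfM.
  rewrite mulrAC; apply: ler_wpM2r; first by rewrite invr_ge0 ltW.
  have : `|lambda0 - l| <= `|lambda0| + c.
    by apply: le_trans (ler_normB _ _) _; rewrite lerD2l.
  have := normr_ge0 (lambda0 - l); have := normr_ge0 lambda0.
  have := sqr_ge0 (`|lambda0| - c).
  move=> h1 h2 h3 h4.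
  have : `|lambda0 - l| ^+ 2 <= (`|lambda0| + c) ^+ 2.
    by rewrite ler_sqr ?nnegrE// addr_ge0// ltW.
  have := sqr_ge0 c; nra.
rewrite /C1; lra.
Qed.

Let gap_lower w : - (c / 2 * `|u K.+1 w - z K.+1 w|) <= gap K.+1 w.
Proof.
have [gz _] := g_mean K w.
have := lambdas_optimal (z K.+1 w) (u_ad K w).
rewrite -(fineK gz) -(fineK g_us) -EFinB -EFinD lee_fin => opt.
have := f_convex us (u K.+1 w).
have := dot_le dot_norm (- lambdas) (u K.+1 w - z K.+1 w).
rewrite dotNl normrN => h1 h2.
have : `|lambdas| * `|u K.+1 w - z K.+1 w| <= c / 2 * `|u K.+1 w - z K.+1 w|.
  by rewrite ler_wpM2r// ler_pdivlMr// mulrC.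
rewrite /gap /=; lra.
Qed.

Lemma stochastic_admm_bound :
  let C2 := phi * varrho ^+ 2 / (2 * M) + C1 in
  let gap_ w := ((f (u K.+1 w))%:E + g (z K.+1 w) - (f us)%:E - g us)%E in
  [/\ P.-integrable setT gap_,
      (\int[P]_w gap_ w <= (C2 / K.+1%:R)%:E)%E,
      P.-integrable setT (fun w => (`|u K.+1 w - z K.+1 w|)%:E) &
      (\int[P]_w (`|u K.+1 w - z K.+1 w|)%:E <= (2 * C2 / (c * K.+1%:R))%:E)%E].
Proof.
move=> C2 gap_.
have K0 : 0 < K.+1%:R :> R by rewrite ltr0n.
have [au az] := approximable_iterates K.+1.
pose B w := K.+1%:R^-1 * (C1 + \sum_(k < K.+1) noise k w).
have [iN IN] := noise_sum_integral K.+1.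
have BE : (fun w => (B w)%:E) = (fun w => (K.+1%:R^-1)%:E *
    (cst C1%:E w + (\sum_(k < K.+1) noise k w)%:E))%E.
  by apply/funext => w; rewrite /cst -EFinD -EFinM.
have iC1 : P.-integrable setT (cst C1%:E) by exact:
    finite_measure_integrable_cst.
have iCN := integrableD measurableT iC1 iN.
have iB : P.-integrable setT (fun w => (B w)%:E) by rewrite BE;
    exact: integrableZl.
have IB : (\int[P]_w (B w)%:E <= (C2 / K.+1%:R)%:E)%E.
  rewrite BE integralZl// integralD//.
  have -> : (\int[P]_w cst C1%:E w = C1%:E)%E.
    by rewrite integral_cst// -[RHS]mule1; congr (_ * _)%E;
        exact: probability_setT.
  rewrite mulrC EFinM; apply: lee_wpmul2l;
      first by rewrite lee_fin invr_ge0 ltW.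
  have -> : C2%:E = (C1%:E + (phi * varrho ^+ 2 / (2 * M))%:E)%E by rewrite
      /C2 addrC.
  exact: leeD2l.
have gapE : gap_ = fun w => (gap K.+1 w)%:E.
  apply/funext => w; have [gz _] := g_mean K w.
  by rewrite /gap_ /gap -(fineK gz) -(fineK g_us).
have mgap : measurable_fun setT gap_.
  have mu_ : measurable_fun setT (fun w => (f (u K.+1 w))%:E).
    by apply/measurable_EFinP; exact: (approximable_measurable au f_continuous).
  apply: emeasurable_funB; last exact: measurable_cst.
  apply: emeasurable_funB; last exact: measurable_cst.
  by apply: emeasurable_funD => //;
      exact: (approximable_measurable_lsc az g_lsc).
have mdist : measurable_fun setT (fun w => (`|u K.+1 w - z K.+1 w|)%:E).
  by apply/measurable_EFinP; apply: approximable_measurable_norm;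
      exact: approximableB.
have gapB w : gap K.+1 w + c * `|u K.+1 w - z K.+1 w| <= B w.
  by rewrite /B ler_pdivlMl//; exact: gap_penalty.
(* The negative part of the gap uses at most half of the penalty; the other half yields the factor
   [2 / c] of the second bound. *)
have distB w : c / 2 * `|u K.+1 w - z K.+1 w| <= B w.
  by have := gapB w; have := gap_lower w; lra.
have cd w : 0 <= c / 2 * `|u K.+1 w - z K.+1 w|.
  by rewrite mulr_ge0// divr_ge0// ltW.
(* [B] also dominates the absolute value: [gap >= - c/2 |u - z| >= - B]. *)
have igap : P.-integrable setT gap_.
  apply: (le_integrable measurableT mgap _ iB) => w _.
  rewrite gapE !abse_EFin lee_fin [leRHS]ger0_norm; last first.
    exact: le_trans (cd w) (distB w).
  rewrite ler_norml; have := gapB w; have := gap_lower w; have := distB w;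
      have := cd w.
  by move=> *; apply/andP; split; lra.
have idist : P.-integrable setT (fun w => (`|u K.+1 w - z K.+1 w|)%:E).
  have iB' := integrableZl measurableT (2 / c) iB.
  apply: (le_integrable measurableT mdist _ iB') => w _.
  rewrite -EFinM !abse_EFin lee_fin normr_id.
  apply: le_trans (ler_norm _); rewrite mulrAC ler_pdivlMr//.
  by have := distB w; lra.
split=> //.
  apply: le_trans IB; apply: le_integral => // w _.
  by rewrite gapE lee_fin; have := gapB w; have := cd w; lra.
have -> : 2 * C2 / (c * K.+1%:R) = 2 / c * (C2 / K.+1%:R).
  by field; rewrite !gt_eqF.
apply: (@le_trans _ _ (\int[P]_w ((2 / c)%:E * (B w)%:E))%E).
  apply: le_integral => //; first exact: integrableZl.
  move=> w _; rewrite -EFinM lee_fin mulrAC ler_pdivlMr//.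
  by have := distB w; lra.
rewrite integralZl// [leRHS]EFinM; apply: lee_wpmul2l => //.
by rewrite lee_fin divr_ge0// ltW.
Qed.

End conclusion.

End stochastic_admm_analysis.

Theorem theorem2p8 (R : realType)
  (U : completeNormedModType R) (dot : {dot U for idfun})
  (dot_norm : forall x : U, dot x x = `|x| ^+ 2)
  (Uad : set U) (Uad0 : Uad !=set0) (Uad_closed : closed Uad)
  (Uad_convex : convex_set (Uad : set (convex_lmodType U)))
  (d : measure_display) (Omega : measurableType d) (P : probability Omega R)
  (n : nat) (Xi : set (n.-tuple R)) (xi : {RV P >-> n.-tuple R})
  (xi_Xi : forall w, Xi (xi w))
  (F : U -> n.-tuple R -> R) (gradF : U -> n.-tuple R -> U)
  (F_convex : forall y, Xi y ->
    convex_function (setT : set (convex_lmodType U)) (F ^~ y))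
  (F_grad : forall y, Xi y -> forall x, is_gradient dot (F ^~ y) x (gradF x y))
  (f : U -> R) (gradf : U -> U)
  (F_integrable : forall x, P.-integrable setT (fun w => (F x (xi w))%:E))
  (f_def : forall x, (f x)%:E = 'E_P[fun w => F x (xi w)]%E)
  (f_grad : forall x, is_gradient dot f x (gradf x))
  (g : U -> \bar R) (g_proper : eproper g) (g_lsc : lower_semicontinuous g)
  (g_convex : econvex g)
  (L : R)
  (f_convex : forall x y, f x + dot (gradf x) (y - x) <= f y)
  (f_smooth : forall x y, `|gradf x - gradf y| <= L * `|x - y|)
  (varrho : R)
  (gradF_measurable : forall x, strongly_measurable Xi (gradF x))
  (gradF_unbiased : forall x,
    has_bochner_expectation P (fun w => gradF x (xi w)) (gradf x))
  (gradF_variance : forall x,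
    ('E_P[fun w => (`|gradF x (xi w) - gradf x| ^+ 2)%R] <= (varrho ^+ 2)%:E)%E)
  (us zs lambdas : U)
  (us_zs_optimal :
    argmin [set p : U * U | Uad p.1 /\ p.1 = p.2]
      (fun p => ((f p.1)%:E + g p.2)%E) (us, zs))
  (lambdas_optimal : forall x y, Uad x ->
    (0 <= g y - g zs + (dot (gradf us) (x - us) - dot lambdas (x - y))%R%:E)%E)
  (mu rho eta : R) (m : nat -> nat) (M : R)
  (mu01 : 0 < mu < 1) (rho_gt0 : 0 < rho) (eta_gt0 : 0 < eta)
  (eta_large : mu * rho / (1 - mu) + L < eta)
  (m_gt1 : forall k, (1 < m k)%N) (M_gt0 : 0 < M)
  (m_sum : series (fun k => (m k)%:R^-1 : R) @ \oo --> M^-1)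
  (sample : forall k, 'I_(m k) -> {RV P >-> n.-tuple R})
  (sample_Xi : forall k i w, Xi (sample k i w))
  (sample_distr : forall k i, identically_distributed (sample k i) xi)
  (sample_indep : mutually_independent
    (fun j : {k : nat & 'I_(m k)} => sample (tag j) (tagged j)))
  (u0 z0 lambda0 : U) (u z v s psi lambda : nat -> Omega -> U)
  (admm : stochastic_admm dot Uad g gradF mu
    (fun=> rho) (fun=> eta) (fun k => k.+1%:R) (fun k i => sample k i)
    u0 z0 lambda0 u z v s psi lambda) :
  forall (c : R) (K : nat), 0 < c -> 2 * `|lambdas| <= c -> (1 <= K)%N ->
  let phi1 := (1 - mu) / (eta * (1 - mu) - mu * rho - L * (1 - mu)) in
  let C2 := varrho ^+ 2 * phi1 / (2 * M)
            + (eta + rho) / 2 * `|u0 - us| ^+ 2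
            + (c ^+ 2 + `|lambda0| ^+ 2) / (mu * rho) in
  let gap := fun w =>
    ((f (u K w))%:E + g (z K w) - (f us)%:E - g zs)%E in
  [/\ P.-integrable setT gap,
      (\int[P]_w gap w <= (C2 / K%:R)%:E)%E,
      P.-integrable setT (fun w => (`|u K w - z K w|)%:E) &
      ('E_P[fun w => `|u K w - z K w|%R] <= (2 * C2 / (c * K%:R))%:E)%E].
Proof.
move=> c K c0 cl K1 phi1 C2 gap.
have [[/= us_ad zsE] _] := us_zs_optimal; subst zs.
case: K K1 @gap => // K _ gap.
have variance x :
    (\int[P]_w (`|gradF x (xi w) - gradf x| ^+ 2)%:E <= (varrho ^+ 2)%:E)%E.
  by have := gradF_variance x; rewrite unlock.
have := stochastic_admm_bound dot_norm Uad_convex xi_Xi F_convex F_grad f_grad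
  g_proper g_lsc g_convex f_convex f_smooth gradF_measurable gradF_unbiased
  variance us_ad lambdas_optimal mu01 rho_gt0 eta_gt0 eta_large m_gt1
  m_sum sample_Xi sample_distr sample_indep admm K c0 cl.
have -> : phi1 * varrho ^+ 2 / (2 * M) + ((eta + rho) / 2 * `|u0 - us| ^+ 2
    + (c ^+ 2 + `|lambda0| ^+ 2) / (mu * rho)) = C2.
  by rewrite /C2 addrA [phi1 * _]mulrC.
by move=> [? ? ? ?]; split=> //; rewrite unlock.
Qed.
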